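(* Let $t$ be an expansion vector for $K^-$. Then $D = TE(K^-,t)$ is SHDS if and only if $t=\begin{bmatrix}t_0 & \tau \end{bmatrix}$, where $t_0\in\mathbb{N}_0$ and $\tau$ is a permutation of $\begin{bmatrix}t_1 & t_1 & t_1 & t_2 \end{bmatrix}$ for some $t_1,t_2\in\mathbb{N}$.
   Context: $\mathbb{N}=\{1,2,\dots\}$ and $\mathbb{N}_0=\{0,1,2,\dots\}$. A digraph $D=(V,E)$ is finite with arc set $E\subseteq V\times V$ and no loops; both $(u,v)$ and $(v,u)$ may belong to $E$, in which case $\{u,v\}$ is called a digon. The Hermitian adjacency matrix $H=H(D)$ has entries $h_{uv}=1$ if $(u,v)\in E$ and $(v,u)\in E$; $h_{uv}=i$ if $(u,v)\in E$ and $(v,u)\notin E$; $h_{uv}=-i$ if $(u,v)\notin E$ and $(v,u)\in E$; and $h_{uv}=0$ otherwise. The spectrum of $D$ is the multiset of eigenvalues of $H(D)$; two digraphs are cospectral if their spectra coincide. A digraph is strongly determined by its Hermitian spectrum (SHDS) if it is isomorphic to every digraph to which it is cospectral. The negative tetrahedron $K^-$ is the digraph on the ordered vertex set $\{1,2,3,4\}$ with digons $\{1,2\}$ and $\{3,4\}$ and (one-directional) arcs $(1,3),(3,2),(2,4),(4,1)$. An expansion vector for a digraph $D$ with vertex set $\{1,\dots,n\}$ is a vector $t=[t_0\ t_1\ \cdots\ t_n]\in\mathbb{N}_0^{n+1}$ with $t_1,\dots,t_n\ge 1$. The twin expansion $D'=TE(D,t)$ has vertex set the disjoint union $V_0\cup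 V_1\cup\cdots\cup V_n$ with $|V_u|=t_u$; the vertices in $V_0$ are isolated, and $H(D')_{u'v'}=H(D)_{uv}$ for all $u'\in V_u$, $v'\in V_v$, $u,v\in\{1,\dots,n\}$ (including $u=v$). *)

(* Defs.v *)
From HB Require Import structures.
From mathcomp Require Import all_boot all_order all_algebra all_field.

Set Implicit Arguments.
Unset Strict Implicit.
Unset Printing Implicit Defensive.

Import Order.TTheory GRing.Theory Num.Theory.
Local Open Scope ring_scope.

Record digraph (V : finType) := Digraph {
  arc : rel V;
  arc_irr : irreflexive arc }.

Definition herm_entry (V : finType) (D : digraph V) (u v : V) : algC :=
  if arc D u v then (if arc D v u then 1 else 'i)
  else if arc D v u then - 'i else 0.

(* Rows and columns are indexed by the vertices through enum_val. *)
Definition herm_mx (V : finType) (D : digraph V) : 'M[algC]_#|V| :=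
  \matrix_(i, j) herm_entry D (enum_val i) (enum_val j).

(* The eigenvalues listed with multiplicity; only meaningful up to perm_eq. *)
Definition spectrum (V : finType) (D : digraph V) : seq algC :=
  sval (closed_field_poly_normal (char_poly (herm_mx D))).

Definition cospectral (V W : finType) (D : digraph V) (D' : digraph W) : Prop :=
  perm_eq (spectrum D) (spectrum D').

Definition isomorphic (V W : finType) (D : digraph V) (D' : digraph W) : Prop :=
  exists2 f : V -> W, bijective f
    & forall u v : V, arc D' (f u) (f v) = arc D u v.

Definition SHDS (V : finType) (D : digraph V) : Prop :=
  forall (W : finType) (D' : digraph W), cospectral D D' -> isomorphic D D'.

(* Vertices 1, 2, 3, 4 are represented by 0, 1, 2, 3. *)
Definition negtet_arc : rel 'I_4 := fun u v =>
  (val u, val v) \in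
    [:: (0, 1); (1, 0); (2, 3); (3, 2);
        (0, 2); (2, 1); (1, 3); (3, 0)]%N.

Lemma negtet_arc_irr : irreflexive negtet_arc.
Proof. by case=> [[|[|[|[|]]]]]. Qed.

Definition negtet : digraph 'I_4 := Digraph negtet_arc_irr.

Definition expansion_vector (n : nat) (t : n.+1.-tuple nat) : Prop :=
  forall u : 'I_n, (0 < tnth t (lift ord0 u))%N.

Section TwinExpansion.

Variables (n : nat) (D : digraph 'I_n) (t : n.+1.-tuple nat).

(* The disjoint union of V_0, ..., V_n with |V_i| = t_i; vertex u : 'I_n of D
   is expanded into V_(lift ord0 u). *)
Definition TE_vertex : finType := {i : 'I_n.+1 & 'I_(tnth t i)}.

Definition TE_arc : rel TE_vertex := fun x y =>
  match unlift ord0 (tag x), unlift ord0 (tag y) with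
  | Some u, Some v => arc D u v
  | _, _ => false
  end.

Lemma TE_arc_irr : irreflexive TE_arc.
Proof.
by move=> x; rewrite /TE_arc; case: unlift => // u; apply: arc_irr.
Qed.

Definition TE : digraph TE_vertex := Digraph TE_arc_irr.

Lemma herm_entry_TE (x y : TE_vertex) (u v : 'I_n) :
  tag x = lift ord0 u -> tag y = lift ord0 v ->
  herm_entry TE x y = herm_entry D u v.
Proof. by move=> xu yv; rewrite /herm_entry /= /TE_arc xu yv !liftK. Qed.

Lemma TE_isolated (x y : TE_vertex) :
  tag x = ord0 -> (arc TE x y = false) * (arc TE y x = false).
Proof. by move=> x0; rewrite /= /TE_arc x0 unlift_none; case: unlift. Qed.

End TwinExpansion.

(* Main.v *)
Require Import Defs.
From mathcomp Require Import all_boot all_order all_algebra all_field.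
From mathcomp Require Import fingroup perm ring lra zify.

(** Let [h] be the entry function of the Hermitian adjacency matrix.  Multiplying
    the vertices by suitable phases turns the matrix of a twin expansion of the
    negative tetrahedron, with part sizes [n_0, ..., n_3], into minus the adjacency
    matrix of the complete multipartite graph with these part sizes.  Two things
    follow: the matrix has rank four and a single negative eigenvalue, and its
    spectrum depends only on the number of vertices and on the elementary symmetric
    functions [e2], [e3], [e4] of the part sizes, not on their arrangement.

    In particular exchanging two part sizes gives a cospectral digraph.  The number
    of digons is [n_0 n_1 + n_2 n_3], and it survives every such exchange only if
    three of the part sizes are equal; this gives the necessity of the condition
    ([SHDS_all_but_one]).

    Conversely, let [D'] be cospectral to an expansion with part sizes
    [a, a, a, b].  Hermitian matrices with equal spectra are unitarily equivalent,
    so [D'] also has rank four and one negative eigenvalue.  Two adjacent vertices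
    span a hyperbolic plane, hence the Schur complement of that plane is positive
    semidefinite.  Its nonnegative diagonal says that no triangle has weight of
    positive real part, and wherever the diagonal vanishes the whole row vanishes
    ([isotropic_row]).  This makes nonadjacency an equivalence relation on the
    non-isolated vertices, with proportional rows inside each class, and together
    with the rank it forces exactly four classes and triangles of weight [-1] only.
    As [-1] is not an entry of [h], proportional rows are equal and four
    representatives induce the negative tetrahedron ([tetrahedral_labelling]): so
    [D'] is itself a twin expansion of the negative tetrahedron.

    Traces of powers give the part sizes of [D'] the same [e2], [e3], [e4] as
    [a, a, a, b].  Since isolated vertices hide [e1] from the spectrum, recovering
    the part sizes takes one more idea: [a] is an eigenvalue of multiplicity two,
    and the characteristic polynomial alternates in sign at the part sizes, which
    leaves room for a double root only at a repeated part size ([perm_esyms]).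
    Finally the automorphism group of the negative tetrahedron is transitive, so the
    position of the part of size [b] is irrelevant, and counting vertices matches
    the isolated ones. *)

Set Implicit Arguments.
Unset Strict Implicit.
Unset Printing Implicit Defensive.

Import Order.TTheory GRing.Theory Num.Theory.
Local Open Scope ring_scope.
Local Open Scope sesquilinear_scope.

(** * Hermitian forms with one negative direction *)

Section HermitianForm.
Variable C : numClosedFieldType.

Definition hform n (H : 'M[C]_n) (y z : 'rV[C]_n) : C := (y *m H *m z^t*) 0 0.

(** A basis-free way of saying that the Hermitian form [H] has at most one
    negative eigenvalue: it is positive semidefinite on some hyperplane. *)
Definition nonneg_on_hyperplane n (H : 'M[C]_n) : Prop :=
  exists v : 'cV[C]_n, forall z : 'rV[C]_n, z *m v = 0 -> 0 <= hform H z z.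

Lemma adjmxM m n p (A : 'M[C]_(m, n)) (B : 'M[C]_(n, p)) :
  (A *m B)^t* = B^t* *m A^t*.
Proof. by rewrite trmx_mul map_mxM. Qed.

Lemma hformDl n (H : 'M[C]_n) a b (x y z : 'rV[C]_n) :
  hform H (a *: x + b *: y) z = a * hform H x z + b * hform H y z.
Proof. by rewrite /hform !mulmxDl -!scalemxAl !mxE. Qed.

Lemma hformDr n (H : 'M[C]_n) a b (x y z : 'rV[C]_n) :
  hform H z (a *: x + b *: y) = a^* * hform H z x + b^* * hform H z y.
Proof.
by rewrite /hform linearD /= !linearZ /= map_mxD !map_mxZ mulmxDr -!scalemxAr !mxE.
Qed.

Lemma hformC n (H : 'M[C]_n) (y z : 'rV[C]_n) :
  H^t* = H -> hform H z y = (hform H y z)^*.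
Proof.
move=> hH; rewrite /hform; have -> : z *m H *m y^t* = (y *m H *m z^t*)^t*.
  by rewrite !adjmxM hH trmxCK mulmxA.
by rewrite mxE mxE.
Qed.

Lemma hform_delta n (H : 'M[C]_n) i j :
  hform H (delta_mx 0 i) (delta_mx 0 j) = H i j.
Proof.
rewrite /hform -rowE; have -> : (delta_mx 0 j : 'rV[C]_n)^t* = delta_mx j 0.
  by rewrite trmx_delta map_delta_mx.
by rewrite -colE !mxE.
Qed.

(** The hypothesis on [Q] makes [H *m Q] the projection of row vectors onto the
    row space of [Q], orthogonally for the form [H]; there [H] takes a negative
    value.  A negative value of the complementary form [H - H Q H] would give a
    plane on which [H] is negative definite, and such a plane meets every
    hyperplane. *)
Lemma schur_complement_nonneg n (H Q : 'M[C]_n) (w z : 'rV[C]_n) :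
  H^t* = H -> Q^t* = Q -> Q *m H *m Q = Q -> nonneg_on_hyperplane H ->
  hform Q w w < 0 -> 0 <= hform (H - H *m Q *m H) z z.
Proof.
move=> hH hQ QHQ [v Hv] w_lt0.
pose y := w *m Q; pose p := z *m (1%:M - H *m Q).
have qy : hform H y y = hform Q w w.
  by rewrite /hform /y adjmxM hQ !mulmxA -(mulmxA w Q H) -(mulmxA w (Q *m H)) QHQ.
have py0 : hform H p y = 0.
  rewrite /hform /y /p adjmxM hQ !mulmxA -(mulmxA z) -(mulmxA z).
  by rewrite !(mulmxBl, mul1mx) -(mulmxA H) -(mulmxA H) QHQ subrr mulmx0 mul0mx mxE.
have yp0 : hform H y p = 0 by rewrite (hformC _ _ hH) py0 rmorph0.
have qp : hform H p p = hform (H - H *m Q *m H) z z.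
  have adjP : (1%:M - H *m Q)^t* = 1%:M - Q *m H.
    by rewrite linearB /= map_mxB trmx1 map_mx1 adjmxM hQ hH.
  rewrite /hform /p adjmxM adjP !mulmxA; congr ((_ *m _) 0 0).
  rewrite -!(mulmxA z); congr (z *m _).
  have E : (1%:M - H *m Q) *m H *m (Q *m H) = 0.
    by rewrite mulmxA !(mulmxBl, mul1mx) -(mulmxA H Q H) -(mulmxA H (Q *m H)) QHQ mulmxA subrr.
  by rewrite mulmxBr mulmx1 E subr0 mulmxBl mul1mx.
(* [al] and [be] put [al *: y + be *: p] on the hyperplane. *)
pose al := (p *m v) 0 0; pose be := - (y *m v) 0 0.
have [al0|al0] := eqVneq al 0.
  rewrite -qp Hv //; apply/matrixP=> i j; rewrite !ord1 [LHS]al0 mxE //.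
have : 0 <= hform H (al *: y + be *: p) (al *: y + be *: p).
  apply: Hv; rewrite mulmxDl -!scalemxAl; apply/matrixP=> i j.
  by rewrite !ord1 !mxE /be /al !mxE mulNr mulrC subrr.
rewrite hformDl !hformDr py0 yp0 !mulr0 addr0 add0r !mulrA qy qp => ge0.
have lt0 : al * al^* * hform Q w w < 0 by rewrite nmulr_llt0 // mul_conjC_gt0.
have : 0 < be * be^* * hform (H - H *m Q *m H) z z.
  by rewrite -(ltrD2l (al * al^* * hform Q w w)) addr0 (lt_le_trans lt0).
have [->|be0] := eqVneq be 0; first by rewrite !mul0r ltxx.
by rewrite pmulr_rgt0 ?mul_conjC_gt0 // => /ltW.
Qed.

(** An isotropic basis vector of a positive semidefinite form lies in its
    radical. *)
Lemma nonneg_diag0_row n (M : 'M[C]_n) i j :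
  M^t* = M -> (forall z, 0 <= hform M z z) -> M i i = 0 -> M i j = 0.
Proof.
move=> hM M_ge0 Mii0; apply/eqP/negP => /negP Mij0.
have Mji : M j i = (M i j)^* by rewrite -{1}hM !mxE.
have Mjj_ge0 : 0 <= M j j by rewrite -hform_delta M_ge0.
(* Moving from [e_j] along [e_i] changes the form linearly, so some multiple of
   [e_i] drives it below zero unless [M i j = 0]; [k] is large enough for that. *)
pose s := M i j * (M i j)^*; have s_gt0 : 0 < s by rewrite mul_conjC_gt0.
pose k := (M j j + 1) / s.
have k_real : k^* = k.
  by apply: conj_Creal; rewrite rpredM ?rpredV ?gtr0_real // ltr_wpDl.
have ksE : k * s = M j j + 1 by rewrite /k divfK ?gt_eqF.
have kc : (- (k * (M i j)^*))^* = - (k * M i j).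
  by rewrite rmorphN rmorphM /= conjCK k_real.
have := M_ge0 ((- (k * (M i j)^*)) *: delta_mx 0 i + 1 *: delta_mx 0 j).
rewrite hformDl !hformDr !hform_delta Mii0 Mji kc.
rewrite rmorph1 !mulr0 add0r !mul1r.
suff -> : - (k * (M i j)^*) * M i j + (- (k * M i j) * (M i j)^* + M j j) =
          - (M j j + 2).
  by rewrite oppr_ge0 lt_geF // ltr_wpDl // ltr0n.
have -> : - (k * (M i j)^*) * M i j + (- (k * M i j) * (M i j)^* + M j j) =
  M j j - (k * s + k * s) by rewrite /s; ring.
by rewrite ksE; ring.
Qed.

Section Edge.
Variables (n : nat) (H : 'M[C]_n) (a b : 'I_n).
Hypotheses (hH : H^t* = H) (Hv : nonneg_on_hyperplane H).
Hypotheses (Haa : H a a = 0) (Hbb : H b b = 0) (Hab : H a b * H b a = 1).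

(** The inverse, extended by zero, of the Gram matrix of the basis vectors [a] and
    [b].  They span a hyperbolic plane, and [H - H Q H] is its Schur complement. *)
Let Q := H a b *: delta_mx a b + H b a *: delta_mx b a.

Lemma edge_complement :
  [/\ (H - H *m Q *m H)^t* = H - H *m Q *m H,
      forall z, 0 <= hform (H - H *m Q *m H) z z
    & forall i j, (H - H *m Q *m H) i j =
        H i j - H i a * H a b * H b j - H i b * H b a * H a j].
Proof.
have conjH i j : (H i j)^* = H j i by rewrite -{1}hH !mxE conjCK.
have hQ : Q^t* = Q.
  rewrite /Q linearD /= !linearZ /= !trmx_delta map_mxD !map_mxZ !map_delta_mx.
  by rewrite /= !conjH addrC.
have mulQ m (A : 'M[C]_(m, n)) i j :
    (A *m Q) i j = A i a * H a b * (j == b)%:R + A i b * H b a * (j == a)%:R.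
  rewrite /Q mulmxDr -!scalemxAr mxE; congr (_ + _).
    rewrite !mxE (bigD1 a) //= big1 ?addr0 => [|k /negPf ka]; rewrite !mxE ?ka ?eqxx /=.
      by rewrite mulrCA mulrA.
    by rewrite mulr0.
  rewrite !mxE (bigD1 b) //= big1 ?addr0 => [|k /negPf kb]; rewrite !mxE ?kb ?eqxx /=.
    by rewrite mulrCA mulrA.
  by rewrite mulr0.
have nzab : H a b != 0.
  by apply: contra_eq_neq Hab => ->; rewrite mul0r eq_sym oner_eq0.
have ab : a != b by apply: contra_neq nzab => ab; rewrite -ab.
have ba : b != a by rewrite eq_sym.
have QHQ : Q *m H *m Q = Q.
  have QHa i : (Q *m H) i a = (i == a)%:R.
    rewrite /Q mulmxDl -!scalemxAl mxE !mxE (bigD1 b) //= big1 ?addr0; last first.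
      by move=> k /negPf kb; rewrite mxE kb andbF mul0r.
    rewrite (bigD1 a) //= big1 ?addr0; last first.
      by move=> k /negPf kb; rewrite mxE kb andbF mul0r.
    by rewrite !mxE !eqxx Haa !andbT !mulr0 addr0 mulrCA Hab mulr1.
  have QHb i : (Q *m H) i b = (i == b)%:R.
    rewrite /Q mulmxDl -!scalemxAl mxE !mxE (bigD1 b) //= big1 ?addr0; last first.
      by move=> k /negPf kb; rewrite mxE kb andbF mul0r.
    rewrite (bigD1 a) //= big1 ?addr0; last first.
      by move=> k /negPf kb; rewrite mxE kb andbF mul0r.
    by rewrite !mxE !eqxx Hbb !andbT !mulr0 add0r mulrCA [H b a * _]mulrC Hab mulr1.
  apply/matrixP=> i j; rewrite mulQ QHa QHb /Q !mxE.
  by case: (i == a); case: (j == a); case: (i == b); case: (j == b);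
     rewrite /= ?(mulr0, mulr1, mul0r, mul1r, add0r, addr0).
split.
- by rewrite linearB /= map_mxB !adjmxM hQ hH mulmxA.
- move=> z; apply: (@schur_complement_nonneg _ _ _ (- H b a *: delta_mx 0 a + 1 *: delta_mx 0 b)) => //.
  rewrite hformDl !hformDr !hform_delta rmorphN /= conjH rmorph1 /Q !mxE !eqxx.
  rewrite (negPf ab) (negPf ba) /= ?(mulr0, mulr1, mul0r, mul1r, add0r, addr0).
  have -> : - H b a * H a b + - H a b * H b a = - 2 * (H a b * H b a) by ring.
  by rewrite Hab mulr1 oppr_lt0 ltr0n.
- move=> i j; rewrite !mxE.
  under eq_bigr do rewrite mulQ mulrDl.
  rewrite big_split /= (bigD1 b) //= big1 ?addr0; last first.
    by move=> k /negPf ->; rewrite mulr0 mul0r.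
  rewrite (bigD1 a) //= big1 ?addr0; last first.
    by move=> k /negPf ->; rewrite mulr0 mul0r.
  by rewrite !eqxx !mulr1 opprD addrA.
Qed.

Lemma edge_diag_ge0 i :
  0 <= H i i - H i a * H a b * H b i - H i b * H b a * H a i.
Proof. by have [_ ge0 <-] := edge_complement; rewrite -hform_delta. Qed.

Lemma edge_isotropic_row i j :
  H i i - H i a * H a b * H b i - H i b * H b a * H a i = 0 ->
  H i j = H i a * H a b * H b j + H i b * H b a * H a j.
Proof.
have [hM ge0 ME] := edge_complement.
rewrite -ME => /(nonneg_diag0_row j hM ge0); rewrite ME => /eqP.
by rewrite -addrA -opprD subr_eq0 => /eqP.
Qed.
End Edge.
End HermitianForm.

(** * Cospectrality as unitary equivalence *)

Section UnitaryEquivalence.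
Variable C : numClosedFieldType.

Definition unitarily_equivalent m n (H : 'M[C]_m) (K : 'M[C]_n) : Prop :=
  exists U : 'M[C]_(n, m),
    [/\ U *m U^t* = 1%:M, U^t* *m U = 1%:M & K = U *m H *m U^t*].

Lemma unitarily_equivalent_sym m n (H : 'M[C]_m) (K : 'M[C]_n) :
  unitarily_equivalent H K -> unitarily_equivalent K H.
Proof.
case=> U [U1 U2 ->]; exists (U^t*); rewrite trmxCK; split=> //.
by rewrite !mulmxA U2 mul1mx -mulmxA U2 mulmx1.
Qed.

Lemma char_poly_similar n (P A P' : 'M[C]_n) :
  P *m P' = 1%:M -> char_poly (P *m A *m P') = char_poly A.
Proof.
move=> PP'; rewrite /char_poly.
have -> : char_poly_mx (P *m A *m P') =
    map_mx polyC P *m char_poly_mx A *m map_mx polyC P'.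
  rewrite /char_poly_mx mulmxBr mulmxBl -!map_mxM; congr (_ - _).
  by rewrite mul_mx_scalar -scalemxAl -map_mxM PP' map_mx1 scalemx1.
rewrite !det_mulmx mulrC mulrA -det_mulmx -map_mxM.
by rewrite (mulmx1C PP') map_mx1 det1 mul1r.
Qed.

(** Hermitian matrices are unitarily diagonalizable, so a Hermitian matrix is
    determined by its spectrum up to unitary equivalence. *)
Lemma eq_char_poly_unitarily_equivalent m n (H : 'M[C]_m) (K : 'M[C]_n) :
  H^t* = H -> K^t* = K ->
  char_poly H = char_poly K <-> unitarily_equivalent H K.
Proof.
move=> hH hK; split; last first.
  case=> U [U1 U2 KE].
  have eqmn : m = n.
    have le p q (A : 'M[C]_(p, q)) (B : 'M[C]_(q, p)) : A *m B = 1%:M -> (p <= q)%N.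
      by move=> AB; rewrite -(mxrank1 C p) -AB (leq_trans (mxrankM_maxl _ _)) ?rank_leq_col.
    by apply/eqP; rewrite eqn_leq (le _ _ _ _ U1) (le _ _ _ _ U2).
  case: _ / eqmn K hK U U1 U2 KE => K _ U U1 _ ->.
  by rewrite char_poly_similar.
move=> eqHK.
have eqmn : m = n.
  by have := congr1 (fun p : {poly C} => size p) eqHK; rewrite !size_char_poly => -[].
case: _ / eqmn K hK eqHK => K hK eqHK.
have diagP (A : 'M[C]_m) : A^t* = A ->
    exists2 U : 'M[C]_m, U \is unitarymx &
    exists2 d : 'rV[C]_m, A = U^t* *m diag_mx d *m U &
      char_poly A = \prod_(i < m) ('X - (d 0 i)%:P).
  move=> hA; have /orthomx_spectralP AE : A \is normalmx by apply/normalmxP; rewrite hA.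
  exists (spectralmx A); first exact: spectral_unitarymx.
  exists (spectral_diag A); first by rewrite -invmx_unitary ?spectral_unitarymx.
  rewrite {1}AE char_poly_similar ?mulVmx ?spectral_unit // char_poly_trig ?diag_mx_is_trig //.
  by apply: eq_bigr => i _; rewrite mxE eqxx.
have [U /unitarymxP U1 [d HE Hd]] := diagP H hH.
have [V /unitarymxP V1 [e KE Ke]] := diagP K hK.
have U2 := mulmx1C U1; have V2 := mulmx1C V1.
have : perm_eq [tuple e 0 i | i < m] [tuple d 0 i | i < m].
  have prodE (f : 'rV[C]_m) : \prod_(x <- [tuple f 0 i | i < m]) ('X - x%:P) =
      \prod_(i < m) ('X - (f 0 i)%:P).
    by rewrite big_tuple; apply: eq_bigr => i _; rewrite tnth_mktuple.
  by apply: prod_XsubC_eq; rewrite !prodE -Hd -Ke.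
case/tuple_permP=> s /val_inj es.
have {}es i : e 0 i = d 0 (s i).
  have := congr1 (fun t : m.-tuple C => tnth t i) es.
  by rewrite !tnth_mktuple.
have eE : diag_mx e = perm_mx s *m diag_mx d *m (perm_mx s)^t*.
  rewrite tr_perm_mx map_perm_mx; apply/matrixP=> i j.
  rewrite -col_permE -row_permE !mxE es.
  by rewrite (inj_eq perm_inj).
have P1 : perm_mx s *m (perm_mx s)^t* = 1%:M :> 'M[C]_m.
  by rewrite tr_perm_mx map_perm_mx -perm_mxM mulgV perm_mx1.
exists (V^t* *m perm_mx s *m U); rewrite !adjmxM trmxCK.
have P2 := mulmx1C P1.
split.
- by rewrite !mulmxA -(mulmxA _ U) U1 mulmx1 -(mulmxA _ (perm_mx s)) P1 mulmx1.
- by rewrite !mulmxA -(mulmxA _ V) V1 mulmx1 -(mulmxA _ _ (perm_mx s)) P2 mulmx1.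
- rewrite HE KE eE !mulmxA -(mulmxA _ U) U1 mulmx1.
  by rewrite -(mulmxA _ U (U^t*)) U1 mulmx1.
Qed.

Lemma mxrank_unitarily_equivalent m n (H : 'M[C]_m) (K : 'M[C]_n) :
  unitarily_equivalent H K -> \rank H = \rank K.
Proof.
have le m' n' (A : 'M[C]_m') (B : 'M[C]_n') :
    unitarily_equivalent A B -> (\rank B <= \rank A)%N.
  by case=> U [_ _ ->]; rewrite (leq_trans (mxrankM_maxl _ _)) ?mxrankM_maxr.
move=> HK; apply/eqP; rewrite eqn_leq !le //; exact: unitarily_equivalent_sym.
Qed.

Lemma nonneg_on_hyperplane_unitarily_equivalent m n (H : 'M[C]_m) (K : 'M[C]_n) :
  unitarily_equivalent H K -> nonneg_on_hyperplane H -> nonneg_on_hyperplane K.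
Proof.
case=> U [_ _ ->] [v Hv]; exists (U *m v) => z zv.
rewrite /hform.
have -> : z *m (U *m H *m U^t*) *m z^t* = z *m U *m H *m (z *m U)^t*.
  by rewrite adjmxM !mulmxA.
by apply: Hv; rewrite -mulmxA.
Qed.

Lemma mxtrace_unitarily_equivalent m n (H : 'M[C]_m) (K : 'M[C]_n) :
  unitarily_equivalent H K ->
  [/\ \tr (H *m H) = \tr (K *m K), \tr (H *m H *m H) = \tr (K *m K *m K)
    & \tr (H *m H *m (H *m H)) = \tr (K *m K *m (K *m K))].
Proof.
case=> U [_ U2 ->].
have mulU (A B : 'M[C]_m) :
    (U *m A *m U^t*) *m (U *m B *m U^t*) = U *m (A *m B) *m U^t*.
  by rewrite !mulmxA -(mulmxA _ _ U) U2 mulmx1.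
have trU (A : 'M[C]_m) : \tr (U *m A *m U^t*) = \tr A.
  by rewrite mxtrace_mulC mulmxA U2 mul1mx.
by rewrite !mulU !trU.
Qed.
End UnitaryEquivalence.

Lemma herm_entryC (V : finType) (D : digraph V) x y :
  (herm_entry D x y)^* = herm_entry D y x.
Proof.
rewrite /herm_entry; case: ifP; case: ifP;
by rewrite ?rmorph1 ?rmorph0 ?rmorphN /= ?conjCi ?opprK.
Qed.

Lemma hermitian_herm_mx (V : finType) (D : digraph V) :
  (herm_mx D)^t* = herm_mx D.
Proof. by apply/matrixP=> i j; rewrite !mxE herm_entryC. Qed.

(** This transports every unitary invariant of the Hermitian adjacency matrix
    (rank, signature, traces of powers) between cospectral digraphs. *)
Lemma cospectral_unitarily_equivalent (V W : finType) (D : digraph V) (D' : digraph W) :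
  cospectral D D' <-> unitarily_equivalent (herm_mx D) (herm_mx D').
Proof.
have charE (X : finType) (E : digraph X) :
    char_poly (herm_mx E) = \prod_(z <- spectrum E) ('X - z%:P).
  rewrite /spectrum; case: closed_field_poly_normal => s /= {1}->.
  by rewrite (monicP (char_poly_monic _)) scale1r.
rewrite -eq_char_poly_unitarily_equivalent ?hermitian_herm_mx // !charE.
by split=> [/(perm_big _)-> //|]; apply: prod_XsubC_eq.
Qed.

(** * Switching and labelled twin expansions *)

Lemma sum_enum_val (V : finType) (F : V -> algC) :
  \sum_(i < #|V|) F (enum_val i) = \sum_x F x.
Proof.
by rewrite [RHS](reindex (@enum_val _ (mem V))) //; apply: onW_bij; exact: enum_val_bij.
Qed.

Lemma sum_enum_rank (V : finType) (F : 'I_#|V| -> algC) :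
  \sum_i F i = \sum_x F (enum_rank x).
Proof. by rewrite -(sum_enum_val (fun x => F (enum_rank x))); apply: eq_bigr => i _; rewrite enum_valK. Qed.

Section Switching.
Variables (V W : finType) (D : digraph V) (D' : digraph W).

(** Conjugating the Hermitian adjacency matrix by a monomial unitary matrix, that
    is, relabelling the vertices and multiplying each by a phase, keeps the
    spectrum. *)
Lemma switching_cospectral (f : V -> W) (e : V -> algC) :
  bijective f -> (forall x, e x * (e x)^* = 1) ->
  (forall x y, herm_entry D' (f x) (f y) = e x * herm_entry D x y * (e y)^*) ->
  cospectral D D'.
Proof.
case=> g fK gK e1 hf; apply/cospectral_unitarily_equivalent.
pose U := \matrix_(i < #|W|, j < #|V|)
  (if enum_val i == f (enum_val j) then e (enum_val j) else 0).
have mulUl m (A : 'M_(#|V|, m)) i j :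
    (U *m A) i j = e (g (enum_val i)) * A (enum_rank (g (enum_val i))) j.
  rewrite mxE (bigD1 (enum_rank (g (enum_val i)))) //= mxE enum_rankK gK eqxx.
  rewrite big1 ?addr0 // => k kn; rewrite mxE; case: eqP => [E|]; last by rewrite mul0r.
  by case/eqP: kn; rewrite E fK enum_valK.
have U1 : U *m U^t* = 1%:M.
  apply/matrixP=> i j; rewrite mulUl !mxE enum_rankK gK eq_sym (inj_eq enum_val_inj).
  by case: eqP => [->|]; rewrite ?e1 ?rmorph0 ?mulr0.
exists U; split=> //.
- apply/matrixP=> i j; rewrite mxE.
  under eq_bigr do rewrite !mxE.
  rewrite (bigD1 (enum_rank (f (enum_val i)))) //= enum_rankK eqxx big1 ?addr0.
    rewrite (inj_eq (can_inj fK)) (inj_eq enum_val_inj).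
    by rewrite mxE; case: eqP => [->|]; rewrite ?mulr0 // mulrC e1.
  move=> k kn; case: eqP => [E|]; last by rewrite rmorph0 mul0r.
  by case/eqP: kn; rewrite -E enum_valK.
- apply/matrixP=> i j.
  have -> : U *m herm_mx D *m U^t* = U *m (U *m (herm_mx D))^t*.
    by rewrite adjmxM hermitian_herm_mx mulmxA.
  rewrite mulUl [in RHS]mxE [in RHS]mxE mulUl !mxE !enum_rankK.
  rewrite rmorphM /= -[in LHS](gK (enum_val i)) -[in LHS](gK (enum_val j)) hf.
  rewrite -mulrA; congr (_ * _); rewrite mulrC; congr (_ * _).
  by rewrite herm_entryC.
Qed.

(** The entry at [x], [y] determines whether there is an arc from [x] to [y], as
    [1] and ['i] differ from [- 'i] and [0]. *)
Lemma isomorphic_herm_entry (f : V -> W) :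
  (forall x y, herm_entry D' (f x) (f y) = herm_entry D x y) ->
  forall x y, Defs.arc D' (f x) (f y) = Defs.arc D x y.
Proof.
have nz1 : ('i : algC) != 0 by rewrite neq0Ci.
move=> hf x y; have := hf x y; rewrite /herm_entry.
have ni : ('i : algC) == - 'i = false by rewrite -subr_eq0 opprK -mulr2n mulrn_eq0 (negPf nz1).
have i1 : ('i : algC) == 1 = false.
  by apply/negP=> /eqP /(congr1 (fun z => z ^+ 2)); rewrite sqrCi expr1n => /eqP;
     rewrite eq_sym -subr_eq0 opprK (eqr_nat _ 2 0).
have i2 : 1 == - ('i : algC) = false.
  by apply/negP=> /eqP /(congr1 (fun z => z ^+ 2)); rewrite sqrrN sqrCi expr1n => /eqP;
     rewrite -subr_eq0 opprK (eqr_nat _ 2 0).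
do 4!case: ifP => //; move=> _ _ _ _ /eqP; rewrite ?oppr_eq0 ?oner_eq0 ?ni ?i1 ?i2 ?(negPf nz1) //;
by rewrite eq_sym ?oppr_eq0 ?oner_eq0 ?ni ?i1 ?i2 ?(negPf nz1).
Qed.
End Switching.

(** These phases switch the negative tetrahedron into minus the complete graph
    [K_4]; see [herm_entry_negtet]. *)
Definition tet_phase (u : 'I_4) : algC := nth 0 [:: 1; -1; 'i; - 'i] u.

Lemma tet_phase_unit u : tet_phase u * (tet_phase u)^* = 1.
Proof.
case: u => [[|[|[|[|//]]]] ?]; rewrite /tet_phase /=.
- by rewrite rmorph1 mulr1.
- by rewrite rmorphN rmorph1 mulrNN mulr1.
- by rewrite conjCi mulrN -expr2 sqrCi opprK.
- by rewrite rmorphN /= conjCi opprK mulNr -expr2 sqrCi opprK.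
Qed.

Lemma herm_entry_negtet u v :
  herm_entry negtet u v = tet_phase u * (tet_phase v)^* * ((u == v)%:R - 1).
Proof.
have ii : 'i * 'i = -1 :> algC by rewrite -expr2 sqrCi.
case: u => [[|[|[|[|//]]]] ?]; case: v => [[|[|[|[|//]]]] ?];
  rewrite /herm_entry /tet_phase /= /negtet_arc /=;
  rewrite ?rmorphN ?rmorph1 /= ?conjCi ?opprK -?val_eqE /= ?subrr ?mulr0 //;
  rewrite ?sub0r ?(mulr1, mul1r, mulrN, mulNr, opprK, ii) //.
Qed.

(** Label [ord0] stands for isolated vertices, which get phase [0]; label
    [lift ord0 u] stands for the twins of vertex [u]. *)
Definition lab_phase (i : 'I_5) : algC :=
  if unlift ord0 i is Some u then tet_phase u else 0.

Lemma lab_phase_norm i : lab_phase i * (lab_phase i)^* = (i != ord0)%:R.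
Proof.
rewrite /lab_phase; case: (unliftP ord0 i) => [u ->|->]; last by rewrite mul0r eqxx.
by rewrite tet_phase_unit eq_sym neq_lift.
Qed.

Definition lab_herm (i j : 'I_5) : algC :=
  lab_phase i * (lab_phase j)^* * ((i == j)%:R - 1).

(** A labelling of [D] exhibits it as a twin expansion of the negative
    tetrahedron whose part sizes are the fiber cardinalities. *)
Definition labelling (V : finType) (D : digraph V) (r : V -> 'I_5) : Prop :=
  forall x y, herm_entry D x y = lab_herm (r x) (r y).

Lemma lab_herm0 i : (lab_herm ord0 i = 0) * (lab_herm i ord0 = 0).
Proof. by rewrite /lab_herm /lab_phase unlift_none rmorph0 !(mulr0, mul0r). Qed.

Lemma lab_herm_lift u v : lab_herm (lift ord0 u) (lift ord0 v) = herm_entry negtet u v.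
Proof. by rewrite /lab_herm /lab_phase !liftK (inj_eq lift_inj) -herm_entry_negtet. Qed.

Lemma TE_labelling (t : 5.-tuple nat) : labelling (TE negtet t) (@tag _ _).
Proof.
move=> x y; case: (unliftP ord0 (tag x)) => [u xu|x0]; last first.
  by rewrite /herm_entry !(TE_isolated _ _ x0) x0 lab_herm0.
case: (unliftP ord0 (tag y)) => [v yv|y0]; last first.
  by rewrite /herm_entry !(TE_isolated _ _ y0) y0 lab_herm0.
by rewrite (herm_entry_TE _ xu yv) xu yv lab_herm_lift.
Qed.

Section Labelling.
Variables (V : finType) (D : digraph V) (r : V -> 'I_5).
Hypothesis rD : labelling D r.

(** After switching, the form is the sum of the [|S_i|^2] minus [|S|^2], where [S_i]
    adds up the coordinates in part [i] and [S] is the sum of the [S_i]: it is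
    nonnegative where [S] vanishes. *)
Lemma labelling_nonneg_on_hyperplane : nonneg_on_hyperplane (herm_mx D).
Proof.
exists (\col_i lab_phase (r (enum_val i))) => z.
move=> /matrixP/(_ 0 0); rewrite !mxE => z0.
pose y x := z 0 (enum_rank x) * lab_phase (r x).
have {}z0 : \sum_x y x = 0.
  rewrite -sum_enum_val -[RHS]z0; apply: eq_bigr => i _.
  by rewrite /y enum_valK !mxE.
have -> : hform (herm_mx D) z z =
    \sum_x \sum_x' y x * (y x')^* * ((r x == r x')%:R - 1).
  rewrite /hform mxE sum_enum_rank exchange_big /=; apply: eq_bigr => x' _.
  rewrite !mxE sum_enum_rank mulr_suml; apply: eq_bigr => x _.
  rewrite !mxE !enum_rankK rD /lab_herm /y rmorphM /=; ring.
have -> : \sum_x \sum_x' y x * (y x')^* * ((r x == r x')%:R - 1) =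
    \sum_i (\sum_(x | r x == i) y x) * (\sum_(x | r x == i) y x)^*.
  transitivity (\sum_x \sum_(x' | r x' == r x) y x * (y x')^*).
    apply: eq_bigr => x _; rewrite [RHS]big_mkcond /=.
    under eq_bigr do rewrite mulrBr mulr1.
    rewrite big_split /= sumrN -mulr_sumr -rmorph_sum z0 rmorph0 mulr0 subr0.
    apply: eq_bigr => x' _; rewrite eq_sym.
    by case: eqP; rewrite ?mulr1 ?mulr0.
  rewrite (partition_big r predT) //=; apply: eq_bigr => i _.
  rewrite mulr_suml; apply: eq_bigr => x /eqP ->.
  by rewrite rmorph_sum mulr_sumr.
by apply: sumr_ge0 => i _; apply: mul_conjC_ge0.
Qed.

Definition fiber_card (i : 'I_5) : nat := #|[pred x | r x == i]|.

Lemma sum_labelling (F : 'I_5 -> algC) :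
  \sum_x F (r x) = \sum_i (fiber_card i)%:R * F i.
Proof.
rewrite (partition_big r predT) //=; apply: eq_bigr => i _.
rewrite (eq_bigr (fun=> F i)) => [|x /eqP-> //].
by rewrite sumr_const mulr_natl.
Qed.
End Labelling.

(** * Rank *)

Section Rank.
Variables (V : finType) (D : digraph V).

Lemma mxrank_herm_le k (s : 'I_k -> V) :
  (forall x, exists i c, forall y, herm_entry D x y = c * herm_entry D (s i) y) ->
  (\rank (herm_mx D) <= k)%N.
Proof.
move=> Hs; apply: leq_trans (rank_leq_row (rowsub (enum_rank \o s) (herm_mx D))).
apply/mxrankS/row_subP => j; have [i [c hc]] := Hs (enum_val j).
suff -> : row j (herm_mx D) = c *: row i (rowsub (enum_rank \o s) (herm_mx D)).
  by rewrite scalemx_sub ?row_sub.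
by apply/rowP=> l; rewrite !mxE hc /= enum_rankK.
Qed.

(** Up to diagonal scaling, the vertices [s i] induce the matrix [1 - J] with [J]
    the all-ones matrix; it is invertible because its eigenvalues are [1] and
    [1 - k]. *)
Lemma mxrank_herm_ge k (s : 'I_k -> V) (e : 'I_k -> algC) :
  k != 1%N -> (forall i, e i != 0) ->
  (forall i j, herm_entry D (s i) (s j) = e i * (e j)^* * ((i == j)%:R - 1)) ->
  (k <= \rank (herm_mx D))%N.
Proof.
move=> k1 e0 hs; have sub := rowsub_sub (enum_rank \o s) (herm_mx D).
apply: leq_trans (mxrankS sub); rewrite row_leq_rank.
apply: inj_row_free => v /matrixP v0; pose S := \sum_i v 0 i * e i.
have vE j : v 0 j * e j = S.
  have := v0 0 (enum_rank (s j)); rewrite !mxE.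
  under eq_bigr do rewrite !mxE /= !enum_rankK hs !mulrA mulrBr mulr1.
  rewrite sumrB -mulr_suml -/S (bigD1 j) //= eqxx mulr1 big1 ?addr0; last first.
    by move=> i /negPf->; rewrite mulr0.
  by move/eqP; rewrite -mulrBl mulf_eq0 conjC_eq0 (negPf (e0 j)) orbF subr_eq0 => /eqP.
have S0 : S = 0.
  have : S = k%:R * S by rewrite {1}/S (eq_bigr _ (fun j _ => vE j)) sumr_const card_ord mulr_natl.
  move/eqP; rewrite -subr_eq0 -{1}[S]mul1r -mulrBl mulf_eq0 subr_eq0 (eqr_nat algC 1 k).
  by rewrite eq_sym (negPf k1) => /eqP.
apply/rowP=> j; rewrite mxE; apply/eqP.
by have /eqP := vE j; rewrite S0 mulf_eq0 (negPf (e0 j)) orbF.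
Qed.
End Rank.

Lemma tet_phase_neq0 u : tet_phase u != 0.
Proof.
by apply: contra_eq_neq (tet_phase_unit u) => ->; rewrite mul0r eq_sym oner_eq0.
Qed.

Lemma mxrank_labelling (V : finType) (D : digraph V) (r : V -> 'I_5) :
  labelling D r -> (forall u, exists x, r x = lift ord0 u) -> \rank (herm_mx D) = 4%N.
Proof.
move=> rD r_onto.
have [s rs] : exists s : 'I_4 -> V, forall u, r (s u) = lift ord0 u.
  exact: fin_all_exists r_onto.
apply/eqP; rewrite eqn_leq; apply/andP; split; last first.
  apply: (@mxrank_herm_ge _ _ _ s tet_phase) => // [u|u v]; first exact: tet_phase_neq0.
  by rewrite rD !rs lab_herm_lift herm_entry_negtet.
apply: (@mxrank_herm_le _ _ _ s) => x.
case: (unliftP ord0 (r x)) => [u xu|x0].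
  by exists u, 1 => y; rewrite mul1r !rD xu rs.
by exists ord0, 0 => y; rewrite rD x0 /lab_herm /lab_phase unlift_none !mul0r.
Qed.

(** * Digraphs of rank four with one negative eigenvalue *)

Lemma mulii : 'i * 'i = -1 :> algC. Proof. by rewrite -expr2 sqrCi. Qed.

Lemma unity4_cases (z : algC) : z ^+ 4 = 1 -> [\/ z = 1, z = -1, z = 'i | z = - 'i].
Proof.
move=> z4; have : (z - 1) * (z + 1) * ((z - 'i) * (z + 'i)) = 0.
  have -> : (z - 1) * (z + 1) * ((z - 'i) * (z + 'i)) =
     z ^+ 4 - 1 - (1 + 'i * 'i) * (z ^+ 2 - 1) by ring.
  by rewrite mulii z4 !subrr mul0r subr0.
move/eqP; rewrite !mulf_eq0 -!orbA !subr_eq0 !addr_eq0.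
by case/or4P=> /eqP; [constructor 1|constructor 2|constructor 3|constructor 4].
Qed.

(** The sum of two fourth roots of unity has absolute value [0], [sqrt 2] or [2]. *)
Lemma unity4_add (u v w : algC) : u ^+ 4 = 1 -> v ^+ 4 = 1 -> w ^+ 4 = 1 -> u <> v + w.
Proof.
move=> u4 v4 w4 uvw.
have v0 : v != 0 by apply: contra_eq_neq v4 => ->; rewrite expr0n eq_sym oner_eq0.
pose x := w / v; have wE : w = x * v by rewrite /x divfK.
have x4 : x ^+ 4 = 1 by rewrite /x exprMn w4 exprVn v4 invr1 mulr1.
have : (1 + x) ^+ 4 = 1.
  have uE : u = (1 + x) * v by rewrite uvw wE mulrDl mul1r.
  by move: u4; rewrite uE exprMn v4 mulr1.
have ineq (a b : nat) : a != b -> (a%:R : algC) = b%:R -> False.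
  by move=> ab /eqP; rewrite eqr_nat (negPf ab).
case: (unity4_cases x4) => ->.
- by rewrite (_ : (1 + 1) ^+ 4 = 16%:R) => [/(@ineq 16 1)|]; [apply|ring].
- by rewrite subrr expr0n => /(@ineq 0 1); apply.
- have -> : (1 + 'i) ^+ 4 = ((1 + 'i * 'i) + 2 * 'i) ^+ 2 :> algC by ring.
  rewrite mulii subrr add0r exprMn sqrCi => /eqP.
  by rewrite eq_sym -subr_eq0 (_ : 1 - _ = 5%:R) ?pnatr_eq0 //; ring.
- have -> : (1 - 'i) ^+ 4 = ((1 + 'i * 'i) - 2 * 'i) ^+ 2 :> algC by ring.
  rewrite mulii subrr add0r sqrrN exprMn sqrCi => /eqP.
  by rewrite eq_sym -subr_eq0 (_ : 1 - _ = 5%:R) ?pnatr_eq0 //; ring.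
Qed.

Section HermEntry.
Variables (V : finType) (D : digraph V).
Local Notation h := (herm_entry D).

Lemma herm_entry_irr x : h x x = 0.
Proof. by rewrite /herm_entry arc_irr. Qed.

Lemma herm_entry_cases x y : h x y != 0 -> [\/ h x y = 1, h x y = 'i | h x y = - 'i].
Proof.
rewrite /herm_entry; case: ifP => _; case: ifP => _; rewrite ?eqxx // => _;
by [constructor 1|constructor 2|constructor 3].
Qed.

Lemma herm_entry_unity4 x y : h x y != 0 -> h x y ^+ 4 = 1.
Proof.
case/herm_entry_cases => ->; first by rewrite expr1n.
  by rewrite (exprM _ 2 2) sqrCi sqrrN expr1n.
by rewrite (exprM _ 2 2) sqrrN sqrCi sqrrN expr1n.
Qed.

Lemma herm_entry_unit x y : h x y != 0 -> h x y * h y x = 1.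
Proof.
rewrite -(herm_entryC D x y) => /herm_entry_cases[] ->.
- by rewrite rmorph1 mulr1.
- by rewrite conjCi mulrN mulii opprK.
- by rewrite rmorphN /= conjCi opprK mulNr mulii opprK.
Qed.

Lemma herm_entry_eq0C x y : (h x y == 0) = (h y x == 0).
Proof. by rewrite -herm_entryC conjC_eq0. Qed.

(** The absence of [-1] breaks the symmetry between the fourth roots of unity: it
    forces twins up to a phase to be true twins, and a clique on four vertices to
    carry the orientation of the negative tetrahedron. *)
Lemma neg1_herm_entry x y : h x y <> -1.
Proof.
move=> E; have := @herm_entry_cases x y; rewrite E oppr_eq0 oner_eq0 => /(_ isT).
have sq (z : algC) : z ^+ 2 = -1 -> -1 = z -> False.
  move=> z2 Ez; move: z2; rewrite -Ez sqrrN expr1n => /eqP.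
  by rewrite -subr_eq0 opprK (eqr_nat _ 2 0).
case=> [/eqP|/sq|/sq]; first by rewrite eq_sym -subr_eq0 opprK (eqr_nat _ 2 0).
  by apply; rewrite sqrCi.
by apply; rewrite sqrrN sqrCi.
Qed.
End HermEntry.

Section OneNegative.
Variables (V : finType) (D : digraph V).
Local Notation h := (herm_entry D).
Hypothesis Hv : nonneg_on_hyperplane (herm_mx D).

Let M x y := herm_mx D (enum_rank x) (enum_rank y).
Let ME x y : M x y = h x y. Proof. by rewrite /M mxE !enum_rankK. Qed.

Lemma triangle_re_le0 a b x : h a b != 0 ->
  0 <= - (h x a * h a b * h b x) - h x b * h b a * h a x.
Proof.
move=> hab.
have := @edge_diag_ge0 _ _ (herm_mx D) (enum_rank a) (enum_rank b)
  (hermitian_herm_mx D) Hv.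
rewrite -![herm_mx D _ _]/(M _ _) !ME !herm_entry_irr => /(_ erefl erefl (herm_entry_unit hab) (enum_rank x)).
by rewrite -![herm_mx D _ _]/(M _ _) !ME herm_entry_irr sub0r.
Qed.

(** Equality in [triangle_re_le0] puts [x] in the radical of the Schur complement
    at [a], [b], which determines the row of [x]. *)
Lemma isotropic_row a b x : h a b != 0 ->
  h x a * h a b * h b x + h x b * h b a * h a x = 0 ->
  forall y, h x y = h x a * h a b * h b y + h x b * h b a * h a y.
Proof.
move=> hab x0 y.
have := @edge_isotropic_row _ _ (herm_mx D) (enum_rank a) (enum_rank b)
  (hermitian_herm_mx D) Hv.
rewrite -![herm_mx D _ _]/(M _ _) !ME !herm_entry_irr => /(_ erefl erefl (herm_entry_unit hab) (enum_rank x) (enum_rank y)).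
rewrite -![herm_mx D _ _]/(M _ _) !ME herm_entry_irr; apply.
by rewrite sub0r -opprD x0 oppr0.
Qed.

(** If [x] is not adjacent to [a] then both terms in [isotropic_row] vanish.  This
    serves in two ways: [x] is isolated when it is not adjacent to [b] either, and
    otherwise its row is proportional to the row of [a]. *)
Lemma nonadjacent_row a b x : h a b != 0 -> h x a = 0 ->
  forall y, h x y = h x b * h b a * h a y.
Proof.
move=> hab xa y; have ax : h a x = 0 by rewrite -herm_entryC xa rmorph0.
by rewrite (isotropic_row hab) xa ?ax ?mulr0 !mul0r add0r.
Qed.

Hypothesis rk4 : \rank (herm_mx D) = 4%N.

(** A vertex that misses one of [a], [b], [c] has a row proportional to the row of
    the missed vertex; if all vertices did, the rank would be at most three. *)
Lemma common_neighbour3 a b c : h a b != 0 -> h b c != 0 -> h c a != 0 ->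
  exists d, [/\ h a d != 0, h b d != 0 & h c d != 0].
Proof.
move=> ab bc ca.
case: (pickP [pred d | [&& h a d != 0, h b d != 0 & h c d != 0]]) => [d /and3P[]|no].
  by exists d.
suff : (\rank (herm_mx D) <= 3)%N by rewrite rk4.
apply: (@mxrank_herm_le _ _ _ (fun i : 'I_3 => nth a [:: a; b; c] i)) => x.
have := no x; rewrite /= ![h _ x == 0]herm_entry_eq0C.
have [xa _|_] := eqVneq (h x a) 0; first by exists 0, (h x b * h b a); apply: nonadjacent_row.
have [xb _|_] := eqVneq (h x b) 0; first by exists 1, (h x c * h c b); apply: nonadjacent_row.
have [xc _|//] := eqVneq (h x c) 0; by exists 2, (h x a * h a c); apply: nonadjacent_row.
Qed.

(** The weight [w] is a fourth root of unity with [Re w <= 0].  If it were purely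
    imaginary, the row of [c] would be a combination of those of [a] and [b], and
    at a common neighbour of all three this writes a fourth root of unity as a sum
    of two others. *)
Lemma triangle_weight a b c : h a b != 0 -> h b c != 0 -> h c a != 0 ->
  h a b * h b c * h c a = -1.
Proof.
move=> ab bc ca; have [d [ad bd cd]] := common_neighbour3 ab bc ca.
pose w := h c a * h a b * h b c.
have wE : h a b * h b c * h c a = w by rewrite /w; ring.
have cw : h c b * h b a * h a c = w^*.
  by rewrite /w !rmorphM /= !herm_entryC; ring.
have w4 : w ^+ 4 = 1 by rewrite !exprMn !herm_entry_unity4 ?mulr1.
have w0 : w + w^* <> 0.
  rewrite -cw => /(isotropic_row ab)/(_ d); apply: unity4_add.
  - exact: herm_entry_unity4.
  - by rewrite !exprMn !herm_entry_unity4 ?mulr1.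
  - by rewrite !exprMn !herm_entry_unity4 ?mulr1 // herm_entry_eq0C.
have := @triangle_re_le0 a b c ab; rewrite cw -/w wE.
case: (unity4_cases w4) w0 => -> //.
- by rewrite rmorph1 -opprD oppr_ge0 lt_geF ?addr_gt0.
- by rewrite conjCi subrr.
- by rewrite rmorphN /= conjCi opprK addNr.
Qed.

Lemma triangle_third a b c : h a b != 0 -> h a c != 0 -> h b c != 0 ->
  h b c = - (h b a * h a c).
Proof.
move=> ab ac bc; have ca : h c a != 0 by rewrite herm_entry_eq0C.
have w := triangle_weight ab bc ca.
rewrite -[LHS]mul1r -[LHS]mulr1 -{1}(herm_entry_unit ab) -(herm_entry_unit ca).
have -> : h a b * h b a * h b c * (h c a * h a c) =
  (h a b * h b c * h c a) * (h b a * h a c) by ring.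
by rewrite w mulN1r.
Qed.

Lemma triangle_distinct a b c : h a b != 0 -> h a c != 0 -> h b c != 0 ->
  h a b <> h a c.
Proof.
move=> ab ac bc E; apply: (@neg1_herm_entry _ D b c).
by rewrite (@triangle_third a) // -E mulrC herm_entry_unit.
Qed.

Lemma exists_edge : exists a b, h a b != 0.
Proof.
case: (pickP [pred p : V * V | h p.1 p.2 != 0]) => [[a b] /= ab|no]; first by exists a, b.
suff E : herm_mx D = 0 by move: rk4; rewrite E mxrank0.
by apply/matrixP=> i j; rewrite !mxE; have /= /negbFE/eqP := no (enum_val i, enum_val j).
Qed.

Lemma exists_triangle : exists a b c, [/\ h a b != 0, h a c != 0 & h b c != 0].
Proof.
have [a [b ab]] := exists_edge.
case: (pickP [pred c | (h a c != 0) && (h b c != 0)]) => [c /andP[]|no].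
  by exists a, b, c.
suff : (\rank (herm_mx D) <= 2)%N by rewrite rk4.
have ba : h b a != 0 by rewrite herm_entry_eq0C.
apply: (@mxrank_herm_le _ _ _ (fun i : 'I_2 => nth a [:: a; b] i)) => x.
have := no x; rewrite /= ![h _ x == 0]herm_entry_eq0C.
have [xa _|_] := eqVneq (h x a) 0; first by exists 0, (h x b * h b a); apply: nonadjacent_row.
have [xb _|//] := eqVneq (h x b) 0; by exists 1, (h x a * h a b); apply: nonadjacent_row.
Qed.

(** In a clique on [a], [p], [q], [r] the entries [h a p], [h a q], [h a r] are
    distinct elements of [{1, 'i, - 'i}]; naming the vertices after these values
    fixes the other entries through [triangle_third]. *)
Lemma exists_tetrahedron : exists s : 'I_4 -> V,
  forall u v, h (s u) (s v) = herm_entry negtet u v.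
Proof.
have [a [p [q [r [ap aq ar [pq pr qr [E1 E2 E3]]]]]]] : exists a p q r,
    [/\ h a p != 0, h a q != 0, h a r != 0
     & [/\ h p q != 0, h p r != 0, h q r != 0
     & [/\ h a p = 1, h a q = 'i & h a r = - 'i]]].
  have [a [b [c [ab ac bc]]]] := exists_triangle.
  have ca : h c a != 0 by rewrite herm_entry_eq0C.
  have [d [ad bd cd]] := common_neighbour3 ab bc ca.
  have nbc := triangle_distinct ab ac bc.
  have nbd := triangle_distinct ab ad bd.
  have ncd := triangle_distinct ac ad cd.
  exists a.
  case: (herm_entry_cases ab) nbc nbd => Eb; rewrite Eb => nbc nbd;
  case: (herm_entry_cases ac) nbc ncd => Ec; rewrite Ec => nbc ncd //;
  case: (herm_entry_cases ad) nbd ncd => Ed; rewrite Ed => nbd ncd //;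
    [exists b, c, d|exists b, d, c|exists c, b, d|exists d, b, c|exists c, d, b|exists d, c, b];
    by split=> //; split=> //; rewrite herm_entry_eq0C.
pose s (u : 'I_4) := nth a [:: a; p; q; r] u; exists s.
have sa u : u != 0 -> h a (s u) = - (tet_phase u)^*.
  case: u => [[|[|[|[|//]]]] ?] //= _; rewrite /s /tet_phase /=.
  - by rewrite rmorphN rmorph1 opprK.
  - by rewrite conjCi opprK.
  - by rewrite rmorphN /= conjCi !opprK.
have sadj u v : u != v -> h (s u) (s v) != 0.
  by case: u => [[|[|[|[|//]]]] ?]; case: v => [[|[|[|[|//]]]] ?] //= _;
    rewrite /s /= // herm_entry_eq0C.
have s0 : s 0 = a by [].
move=> u v; rewrite herm_entry_negtet.
have [->|uv] := eqVneq u v; first by rewrite subrr mulr0 herm_entry_irr.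
rewrite sub0r mulrN1.
have [u0|u0] := eqVneq u 0.
  rewrite u0 s0 sa; last by rewrite -u0 eq_sym.
  by rewrite /tet_phase /= mul1r.
have [v0|v0] := eqVneq v 0.
  rewrite v0 s0 -herm_entryC sa // rmorphN /= conjCK.
  by rewrite /tet_phase /= rmorph1 mulr1.
rewrite (@triangle_third a); last exact: sadj.
- rewrite -(herm_entryC D a (s u)) !sa // rmorphN /= conjCK; ring.
- by rewrite -s0 sadj // eq_sym.
- by rewrite -s0 sadj // eq_sym.
Qed.

(** A vertex adjacent to the whole tetrahedron would complete a clique of rank
    five.  Any other non-isolated vertex has a row proportional to that of some
    tetrahedron vertex; this row takes all three values [1], ['i], [- 'i], and the
    only fourth root of unity that keeps them away from [-1] is [1]. *)
Lemma tetrahedral_labelling : exists2 r : V -> 'I_5, labelling D r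
  & forall u, exists x, r x = lift ord0 u.
Proof.
have [s hs] := exists_tetrahedron.
pose row (i : 'I_5) y := if unlift ord0 i is Some u then h (s u) y else 0.
have all_values u : exists v1 v2 v3, [/\ h (s u) (s v1) = 1, h (s u) (s v2) = 'i & h (s u) (s v3) = - 'i].
  case: u => [[|[|[|[|//]]]] ?].
  - by exists 1, 2, 3; rewrite !hs.
  - by exists 0, 3, 2; rewrite !hs.
  - by exists 3, 1, 0; rewrite !hs.
  - by exists 2, 0, 1; rewrite !hs.
have sadj u v : u != v -> h (s u) (s v) != 0.
  by move=> uv; rewrite hs herm_entry_negtet (negPf uv) sub0r !mulf_neq0 ?oppr_eq0 ?oner_eq0 ?conjC_eq0 ?tet_phase_neq0.
have rowP x : exists i, [forall y, h x y == row i y].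
  have [x0|/forallPn[z xz]] := boolP [forall y, h x y == 0].
    exists ord0; apply/forallP => y; rewrite /row unlift_none; exact: (forallP x0).
  have [u xu] : exists u, h x (s u) = 0.
    case: (pickP [pred u | h x (s u) == 0]) => [u /eqP|no]; first by exists u.
    suff : (5 <= \rank (herm_mx D))%N by rewrite rk4.
    (* [x] and the tetrahedron form a clique; [e] holds its phases relative to [x]. *)
    pose k (i : 'I_5) := if unlift ord0 i is Some u then s u else x.
    pose e (i : 'I_5) := if unlift ord0 i is Some u then - h (s u) x else 1.
    have sx u : h (s u) x != 0 by rewrite herm_entry_eq0C; have /= /negbT := no u.
    apply: (@mxrank_herm_ge _ _ _ k e) => // [i|i j].
      by rewrite /e; case: unlift => [u|]; rewrite ?oner_eq0 ?oppr_eq0.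
    have [->|ij] := eqVneq i j; first by rewrite subrr mulr0 herm_entry_irr.
    rewrite sub0r mulrN1 /k /e.
    case: (unliftP ord0 i) ij => [u ->|->]; case: (unliftP ord0 j) => [v ->|->] //.
    - rewrite (inj_eq lift_inj) => uv.
      rewrite (@triangle_third x) ?sadj //; try by rewrite herm_entry_eq0C.
      by rewrite rmorphN /= herm_entryC; ring.
    - by move=> _; rewrite rmorph1; ring.
    - by move=> _; rewrite rmorphN /= herm_entryC; ring.
  have [v uv] : exists v : 'I_4, u != v.
    by exists (if u == 0 then 1 else 0); case: (eqVneq u 0) => [->|].
  have rowx := nonadjacent_row (sadj _ _ uv) xu.
  set c := h x (s v) * h (s v) (s u) in rowx.
  have xv : h x (s v) != 0.
    by apply: contraNneq xz => xv; rewrite rowx /c xv !mul0r.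
  have c4 : c ^+ 4 = 1.
    by rewrite exprMn !herm_entry_unity4 ?mulr1 // sadj // eq_sym.
  have c1 : c = 1.
    have [v1 [v2 [v3 [E1 E2 E3]]]] := all_values u.
    case: (unity4_cases c4) => // cE; exfalso.
    - by apply: (@neg1_herm_entry _ D x (s v1)); rewrite rowx E1 cE mulr1.
    - by apply: (@neg1_herm_entry _ D x (s v2)); rewrite rowx E2 cE mulii.
    - by apply: (@neg1_herm_entry _ D x (s v3)); rewrite rowx E3 cE mulrNN mulii.
  by exists (lift ord0 u); apply/forallP => y; rewrite rowx c1 mul1r /row liftK.
have [r rE] := fin_all_exists rowP.
have {}rE x y : h x y = row (r x) y by apply/eqP; move/forallP: (rE x).
have rD : labelling D r.
  move=> x y; rewrite rE /row /lab_herm /lab_phase.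
  case: (unliftP ord0 (r x)) => [u xu|_]; last by rewrite !mul0r.
  rewrite -herm_entryC rE /row.
  case: (unliftP ord0 (r y)) => [v yv|_]; last by rewrite !rmorph0 mulr0 mul0r.
  by rewrite herm_entryC hs herm_entry_negtet xu yv (inj_eq lift_inj).
exists r => // u; exists (s u).
have [v1 [v2 [v3 [E1 E2 E3]]]] := all_values u.
case: (unliftP ord0 (r (s u))) => [w uw|u0].
  rewrite uw; congr lift; apply/eqP; apply: contraTT isT => wu.
  by have := sadj _ _ wu; rewrite -herm_entryC rE /row uw liftK herm_entry_irr rmorph0 eqxx.
by have /eqP := E1; rewrite rE /row u0 unlift_none eq_sym oner_eq0.
Qed.

End OneNegative.

(** * Elementary symmetric functions of four numbers *)

Definition esym2 (R : comNzRingType) (x y z w : R) :=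
  x * y + x * z + x * w + y * z + y * w + z * w.
Definition esym3 (R : comNzRingType) (x y z w : R) :=
  x * y * z + x * y * w + x * z * w + y * z * w.
Definition esym4 (R : comNzRingType) (x y z w : R) := x * y * z * w.

(** The first symmetric function is left out because isolated vertices hide it from
    the spectrum. *)
Definition esyms (R : comNzRingType) (x y z w : R) :=
  (esym2 x y z w, esym3 x y z w, esym4 x y z w).

Section SymmetricFunctions.
Variable R : realDomainType.
Implicit Types a b x y z w : R.

Lemma esyms_swap12 x y z w : esyms y x z w = esyms x y z w.
Proof. by congr (_, _, _); rewrite /esym2 /esym3 /esym4; ring. Qed.

Lemma esyms_swap23 x y z w : esyms x z y w = esyms x y z w.
Proof. by congr (_, _, _); rewrite /esym2 /esym3 /esym4; ring. Qed.

Lemma esyms_swap34 x y z w : esyms x y w z = esyms x y z w.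
Proof. by congr (_, _, _); rewrite /esym2 /esym3 /esym4; ring. Qed.

(** With part sizes [x, y, z, w] the quartic [s^4 - e2 s^2 + 2 e3 s - 3 e4] is the
    nontrivial factor of the characteristic polynomial; at a part size it becomes a
    product of differences. *)
Lemma esyms_quartic x y z w :
  x ^+ 4 - esym2 x y z w * x ^+ 2 + 2 * esym3 x y z w * x - 3 * esym4 x y z w
    = - (x * ((y - x) * (z - x) * (w - x))).
Proof. by rewrite /esym2 /esym3 /esym4; ring. Qed.

(** The remaining two values have the sum and the product of [a] and [b]. *)
Lemma perm_esyms_two a b z w : a != 0 ->
  esyms a a z w = esyms a a a b -> perm_eq [:: a; a; z; w] [:: a; a; a; b].
Proof.
rewrite /esyms /esym2 /esym3 /esym4 => a0 [e2 e3 e4].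
have zw : z * w = a * b.
  by apply: (mulfI a0); apply: (mulfI a0); rewrite !mulrA e4.
have sum : z + w = a + b by apply: (mulfI a0); apply: (mulfI a0); nra.
have : (z - a) * (w - a) = 0 by nra.
move/eqP; rewrite mulf_eq0 !subr_eq0 => /orP[] /eqP E; subst.
  by have -> : w = b by lra.
have -> : z = b by lra.
by apply/seq.permP => c /=; lia.
Qed.

(** The quartic of [a, a, a, b] vanishes at [a], so a value [a] is repeated. *)
Lemma perm_esyms_one a b x y z : a != 0 ->
  esyms a x y z = esyms a a a b -> perm_eq [:: a; x; y; z] [:: a; a; a; b].
Proof.
move=> a0 E; have : a * ((x - a) * (y - a) * (z - a)) = 0.
  apply/eqP; rewrite -oppr_eq0 -esyms_quartic; case: E => -> -> ->.
  by rewrite /esym2 /esym3 /esym4; apply/eqP; ring.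
move/eqP; rewrite !mulf_eq0 (negPf a0) !subr_eq0 /= -orbA => /or3P[] /eqP xyz; subst.
- exact: perm_esyms_two.
- apply: perm_trans (perm_esyms_two a0 (z := x) (w := z) _).
    by apply/seq.permP => c /=; lia.
  by rewrite esyms_swap23.
- apply: perm_trans (perm_esyms_two a0 (z := x) (w := y) _).
    by apply/seq.permP => c /=; lia.
  by rewrite esyms_swap23 esyms_swap34.
Qed.

(** At [a, a, a, b] the quartic is [(s - a)^2 q s] with [q] increasing for
    [s > 0], while at the sorted values [x <= y <= z <= w] it alternates in sign.
    If neither middle value is [a] then [q y >= 0 >= q z], so [y = z] is a root of
    [q], hence a simple root of the quartic with positive derivative; yet the
    double value makes the derivative [- 2 y (y - x) (w - y)]. *)
Lemma esyms_middle a b x y z w : 0 < a -> 0 < b -> 0 < x ->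
  x <= y -> y <= z -> z <= w ->
  esyms x y z w = esyms a a a b -> y = a \/ z = a.
Proof.
move=> a0 b0 x0 xy yz zw [e2 e3 e4].
pose q s := s * s + 2 * a * s - 3 * a * b.
have fE s : s ^+ 4 - esym2 x y z w * s ^+ 2 + 2 * esym3 x y z w * s
    - 3 * esym4 x y z w = (s - a) ^+ 2 * q s.
  by rewrite e2 e3 e4 /q /esym2 /esym3 /esym4; ring.
have fy : (y - a) ^+ 2 * q y = y * ((y - x) * (z - y) * (w - y)).
  by rewrite -fE /esym2 /esym3 /esym4; ring.
have fz : (z - a) ^+ 2 * q z = - (z * ((z - x) * (z - y) * (w - z))).
  by rewrite -fE /esym2 /esym3 /esym4; ring.
have [->|ya] := eqVneq y a; first by left.
have [->|za] := eqVneq z a; first by right.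
have sq_gt0 s : s != a -> 0 < (s - a) ^+ 2.
  by move=> sa; rewrite lt0r sqr_ge0 sqrf_eq0 subr_eq0 sa.
have y0 := lt_le_trans x0 xy; have z0 := lt_le_trans y0 yz.
have qy : 0 <= q y.
  rewrite -(pmulr_rge0 _ (sq_gt0 _ ya)) fy.
  by rewrite mulr_ge0 ?(ltW y0) // !mulr_ge0 ?subr_ge0 // (le_trans yz).
have qz : q z <= 0.
  rewrite -(pmulr_rle0 _ (sq_gt0 _ za)) fz oppr_le0.
  by rewrite mulr_ge0 ?(ltW z0) // !mulr_ge0 ?subr_ge0 // (le_trans xy).
have yz' : y = z.
  apply/eqP; rewrite eq_le yz /= leNgt; apply/negP => lt.
  have : q y < q z by rewrite /q; nra.
  lra.
subst z; have q0 : q y = 0 by lra.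
(* Both sides are the derivative of the quartic at [y]. *)
have dE : 4 * y ^+ 3 - 2 * esym2 x y y w * y + 2 * esym3 x y y w
    = 2 * (y - a) * q y + (y - a) ^+ 2 * (2 * y + 2 * a).
  by rewrite e2 e3 /q /esym2 /esym3; ring.
have dE' : 4 * y ^+ 3 - 2 * esym2 x y y w * y + 2 * esym3 x y y w
    = - (2 * y * (y - x) * (w - y)) by rewrite /esym2 /esym3; ring.
exfalso; have : 0 < (y - a) ^+ 2 * (2 * y + 2 * a) by rewrite mulr_gt0 ?sq_gt0 //; lra.
have : 0 <= 2 * y * (y - x) * (w - y) by apply: mulr_ge0; [apply: mulr_ge0|]; lra.
rewrite q0 mulr0 add0r dE' in dE.
lra.
Qed.

Lemma sort4_ind (P : R -> R -> R -> R -> Prop) :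
  (forall x y z w, P x y z w -> P y x z w) ->
  (forall x y z w, P x y z w -> P x z y w) ->
  (forall x y z w, P x y z w -> P x y w z) ->
  (forall x y z w, x <= y -> y <= z -> z <= w -> P x y z w) ->
  forall x y z w, P x y z w.
Proof.
move=> s12 s23 s34 H.
have P1 x y z w : y <= z -> z <= w -> P x y z w.
  move=> yz zw; have [xy|/ltW yx] := leP x y; first exact: H.
  apply: s12; have [xz|/ltW zx] := leP x z; first exact: H.
  apply: s23; have [xw|/ltW wx] := leP x w; first exact: H.
  by apply: s34; apply: H.
have P2 x y z w : z <= w -> P x y z w.
  move=> zw; have [yz|/ltW zy] := leP y z; first exact: P1.
  apply: s23; have [yw|/ltW wy] := leP y w; first exact: P1.
  by apply: s34; apply: P1.
move=> x y z w; have [zw|/ltW wz] := leP z w; first exact: P2.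
by apply: s34; apply: P2.
Qed.

(** Everything is symmetric in the four values, so they may be sorted before
    [esyms_middle] is applied. *)
Lemma perm_esyms a b x y z w :
  0 < a -> 0 < b -> 0 < x -> 0 < y -> 0 < z -> 0 < w ->
  esyms x y z w = esyms a a a b -> perm_eq [:: x; y; z; w] [:: a; a; a; b].
Proof.
move=> a0 b0; move: x y z w; apply: sort4_ind.
- move=> x y z w H x0 y0 z0 w0; rewrite esyms_swap12 => E.
  by apply: perm_trans (H _ _ _ _ E) => //; apply/seq.permP => c /=; lia.
- move=> x y z w H x0 y0 z0 w0; rewrite esyms_swap23 => E.
  by apply: perm_trans (H _ _ _ _ E) => //; apply/seq.permP => c /=; lia.
- move=> x y z w H x0 y0 z0 w0; rewrite esyms_swap34 => E.
  by apply: perm_trans (H _ _ _ _ E) => //; apply/seq.permP => c /=; lia.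
move=> x y z w xy yz zw x0 _ _ _ E.
have an0 : a != 0 by rewrite gt_eqF.
have [] := esyms_middle a0 b0 x0 xy yz zw E => ya; subst.
- apply: perm_trans (perm_esyms_one an0 (x := x) (y := z) (z := w) _).
    by apply/seq.permP => c /=; lia.
  by rewrite esyms_swap12.
- apply: perm_trans (perm_esyms_one an0 (x := x) (y := y) (z := w) _).
    by apply/seq.permP => c /=; lia.
  by rewrite esyms_swap12 esyms_swap23.
Qed.
End SymmetricFunctions.

(** * Traces of powers *)

Section Traces.
Variables (V : finType) (D : digraph V) (r : V -> 'I_5).
Hypothesis rD : labelling D r.

Let H := herm_mx D.
Let n (u : 'I_4) : algC := (fiber_card r (lift ord0 u))%:R.
Let c (u v : 'I_4) : algC := (u == v)%:R - 1.
Let sq (u v : 'I_4) : algC := \sum_w n w * (c u w * c w v).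

Lemma sum_phase (F : 'I_4 -> algC) (G : 'I_5 -> algC) :
  (forall u, G (lift ord0 u) = F u) ->
  \sum_x lab_phase (r x) * (lab_phase (r x))^* * G (r x) = \sum_u n u * F u.
Proof.
move=> GF; rewrite (sum_labelling r (fun i => lab_phase i * (lab_phase i)^* * G i)).
rewrite big_ord_recl lab_phase_norm eqxx mul0r mulr0 add0r.
by apply: eq_bigr => u _; rewrite lab_phase_norm eq_sym neq_lift mul1r GF.
Qed.

Lemma lab_herm_sq x y : (H *m H) (enum_rank x) (enum_rank y) =
  lab_phase (r x) * (lab_phase (r y))^* *
   (if unlift ord0 (r x) is Some u then if unlift ord0 (r y) is Some v then sq u v else 0 else 0).
Proof.
rewrite mxE sum_enum_rank.
under eq_bigr do rewrite !mxE !enum_rankK !rD /lab_herm.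
case: (unliftP ord0 (r x)) => [u xu|x0]; last first.
  rewrite mulr0 big1 // => z _; by rewrite x0 /lab_phase unlift_none !mul0r.
case: (unliftP ord0 (r y)) => [v yv|y0]; last first.
  rewrite mulr0 big1 // => z _; by rewrite y0 /lab_phase unlift_none rmorph0 mulr0 mul0r mulr0.
rewrite /sq -(@sum_phase (fun w => c u w * c w v) (fun i => ((r x == i)%:R - 1) * ((i == r y)%:R - 1))).
  by rewrite mulr_sumr; apply: eq_bigr => z _; ring.
by move=> w; rewrite xu yv !(inj_eq lift_inj).
Qed.

Lemma sum4 (F : 'I_4 -> algC) : \sum_u F u = F 0 + F 1 + F 2 + F 3.
Proof.
rewrite !big_ord_recl big_ord0 addr0 !addrA.
by congr (F _ + F _ + F _ + F _); apply: val_inj.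
Qed.

(** After switching, the trace of the [k]-th power counts, with sign [(-1)^k], the
    closed walks of length [k] in the complete multipartite graph with the given
    part sizes. *)
Lemma mxtrace_labelling :
  [/\ \tr (H *m H) = 2 * esym2 (n 0) (n 1) (n 2) (n 3),
      \tr (H *m H *m H) = - 6 * esym3 (n 0) (n 1) (n 2) (n 3)
    & \tr (H *m H *m (H *m H)) =
        2 * esym2 (n 0) (n 1) (n 2) (n 3) ^+ 2 + 12 * esym4 (n 0) (n 1) (n 2) (n 3)].
Proof.
have sqE u v : sq u v = n 0 * (c u 0 * c 0 v) + n 1 * (c u 1 * c 1 v)
   + n 2 * (c u 2 * c 2 v) + n 3 * (c u 3 * c 3 v) by rewrite /sq sum4.
have trE (M N : 'M[algC]_#|V|) : \tr (M *m N) = \sum_x \sum_y M (enum_rank x) (enum_rank y) * N (enum_rank y) (enum_rank x).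
  rewrite /mxtrace sum_enum_rank; apply: eq_bigr => x _.
  by rewrite mxE sum_enum_rank.
pose ext (F : 'I_4 -> 'I_4 -> algC) (i j : 'I_5) :=
  if unlift ord0 i is Some u then if unlift ord0 j is Some v then F u v else 0 else 0.
have sum2 (F : 'I_4 -> 'I_4 -> algC) :
    \sum_x \sum_y (lab_phase (r x) * (lab_phase (r x))^*) *
         (lab_phase (r y) * (lab_phase (r y))^*) * ext F (r x) (r y) =
    \sum_u \sum_v n u * n v * F u v.
  under eq_bigr => x _ do under eq_bigr => y _ do rewrite -mulrA.
  under eq_bigr => x _ do rewrite -mulr_sumr.
  rewrite (@sum_phase (fun u => \sum_v n v * F u v)
     (fun i => \sum_y lab_phase (r y) * (lab_phase (r y))^* * ext F i (r y))).
    by apply: eq_bigr => u _; rewrite mulr_sumr; apply: eq_bigr => v _; rewrite mulrA.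
  move=> u; apply: sum_phase => v.
  by rewrite /ext !liftK.
have trsum (M N : 'M[algC]_#|V|) (F G : 'I_4 -> 'I_4 -> algC) :
   (forall x y, M (enum_rank x) (enum_rank y) = lab_phase (r x) * (lab_phase (r y))^* * ext F (r x) (r y)) ->
   (forall x y, N (enum_rank x) (enum_rank y) = lab_phase (r x) * (lab_phase (r y))^* * ext G (r x) (r y)) ->
   \tr (M *m N) = \sum_u \sum_v n u * n v * (F u v * G v u).
  move=> hM hN; rewrite trE -sum2; apply: eq_bigr => x _; apply: eq_bigr => y _.
  rewrite hM hN /ext; case: (unlift _ (r x)) => [u|]; case: (unlift _ (r y)) => [v|]; ring.
have hH x y : H (enum_rank x) (enum_rank y) = lab_phase (r x) * (lab_phase (r y))^* * ext c (r x) (r y).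
  rewrite !mxE !enum_rankK rD /lab_herm /ext.
  case: (unliftP ord0 (r x)) => [u xu|x0]; last by rewrite x0 /lab_phase unlift_none !mul0r.
  case: (unliftP ord0 (r y)) => [v yv|y0]; last by rewrite y0 /lab_phase unlift_none rmorph0 !mulr0 mul0r.
  by rewrite xu yv (inj_eq lift_inj).
split.
- rewrite (trsum _ _ _ _ hH hH) !sum4 /c /= /esym2; ring.
- rewrite (trsum _ _ _ _ lab_herm_sq hH) !sum4 !sqE /c /= /esym3; ring.
- rewrite (trsum _ _ _ _ lab_herm_sq lab_herm_sq) !sum4 !sqE /c /= /esym2 /esym4; ring.
Qed.
End Traces.

(** * Isomorphism and cospectrality of labelled digraphs *)

(** Inside each fiber, match the vertices by their rank in the enumeration. *)
Lemma fiber_bij (V W I : finType) (r : V -> I) (r' : W -> I) :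
  (forall i, #|[pred x | r x == i]| = #|[pred y | r' y == i]|) ->
  exists2 f : V -> W, bijective f & forall x, r' (f x) = r x.
Proof.
move=> rr'.
have card_eq : #|V| = #|W|.
  rewrite -!sum1_card (partition_big r predT) // [RHS](partition_big r' predT) //=.
  by apply: eq_bigr => i _; rewrite !sum1_card rr'.
have [x0|V0] := pickP (@predT V); last first.
  have noV (x : V) : False by have := V0 x.
  exists (fun x => False_rect W (noV x)) => [|x]; last by case: (noV x).
  by apply: inj_card_bij; rewrite ?card_eq // => x; case: (noV x).
have [y0 _] : exists y0, y0 \in [pred y | r' y == r x0].
  by apply/card_gt0P; rewrite -rr'; apply/card_gt0P; exists x0; rewrite inE.
pose A i := enum [pred x | r x == i]; pose B i := enum [pred y | r' y == i].
pose f x := nth y0 (B (r x)) (index x (A (r x))).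
have xA x : x \in A (r x) by rewrite mem_enum inE.
have szA i : size (A i) = size (B i) by rewrite -!cardE rr'.
have fB x : f x \in B (r x) by rewrite mem_nth // -szA index_mem.
have rf x : r' (f x) = r x by have := fB x; rewrite mem_enum inE => /eqP.
exists f => //; apply: inj_card_bij; rewrite ?card_eq // => x x' E.
have rE : r x = r x' by rewrite -!rf E.
have xA' : x \in A (r x') by rewrite -rE.
move/eqP: E; rewrite /f rE nth_uniq ?enum_uniq -?szA ?index_mem //.
by move/eqP/index_inj; apply.
Qed.

(** The rotation along the directed cycle [0 -> 2 -> 1 -> 3 -> 0].  It makes the
    automorphism group transitive, so the position of the exceptional part does
    not matter. *)
Definition tet_rot (u : 'I_4) : 'I_4 := nth 0 [:: 2; 3; 1; 0] u.

Lemma herm_entry_tet_rot u v :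
  herm_entry negtet (tet_rot u) (tet_rot v) = herm_entry negtet u v.
Proof.
rewrite /herm_entry.
by case: u => [[|[|[|[|//]]]] ?]; case: v => [[|[|[|[|//]]]] ?].
Qed.

Lemma tet_automorphism p q : exists g : 'I_4 -> 'I_4,
  [/\ injective g, g p = q
    & forall u v, herm_entry negtet (g u) (g v) = herm_entry negtet u v].
Proof.
have rot_inj : injective tet_rot.
  move=> u v /(congr1 val) /=.
  case: u => [[|[|[|[|//]]]] ?]; case: v => [[|[|[|[|//]]]] ?] //= _; exact: val_inj.
have [k kp] : exists k, iter k tet_rot p = q.
  by case: p => [[|[|[|[|//]]]] ?]; case: q => [[|[|[|[|//]]]] ?];
   [exists 0%N|exists 2%N|exists 1%N|exists 3%N
   |exists 2%N|exists 0%N|exists 3%N|exists 1%N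
   |exists 3%N|exists 1%N|exists 0%N|exists 2%N
   |exists 1%N|exists 3%N|exists 2%N|exists 0%N]; apply: val_inj.
exists (iter k tet_rot); split=> // [|u v].
  by elim: k {kp} => [|k IHk] u v //= /rot_inj/IHk.
by elim: k {kp} => //= k IHk; rewrite herm_entry_tet_rot.
Qed.

Definition lab_map (g : 'I_4 -> 'I_4) (i : 'I_5) : 'I_5 :=
  if unlift ord0 i is Some u then lift ord0 (g u) else ord0.

Lemma lab_mapE g : (lab_map g ord0 = ord0) * (forall u, lab_map g (lift ord0 u) = lift ord0 (g u)).
Proof. by split=> [|u]; rewrite /lab_map ?unlift_none ?liftK. Qed.

Lemma lab_map_inj g : injective g -> injective (lab_map g).
Proof.
move=> gI i j; rewrite /lab_map.
case: (unliftP ord0 i) => [u ->|->]; case: (unliftP ord0 j) => [v ->|->] //.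
by move/lift_inj/gI->.
Qed.

Lemma card_fibers (V : finType) (r : V -> 'I_5) :
  #|V| = (fiber_card r ord0 + \sum_u fiber_card r (lift ord0 u))%N.
Proof.
rewrite -sum1_card (partition_big r predT) //= big_ord_recl.
by congr addn; last apply: eq_bigr => u _; rewrite sum1_card.
Qed.

Lemma fiber_card_map (V : finType) (r : V -> 'I_5) (f : 'I_5 -> 'I_5) i :
  injective f -> fiber_card (f \o r) (f i) = fiber_card r i.
Proof. by move=> fI; apply: eq_card => x; rewrite !inE /= (inj_eq fI). Qed.

Lemma fiber_card_bij (V : finType) (r : V -> 'I_5) (f : 'I_5 -> 'I_5) g i :
  cancel g f -> cancel f g -> fiber_card (f \o r) i = fiber_card r (g i).
Proof. by move=> gK fK; rewrite -{1}(gK i) fiber_card_map //; apply: can_inj fK. Qed.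

Lemma fiber_card_TE (t : 5.-tuple nat) i :
  fiber_card (@tag _ _ : TE_vertex t -> 'I_5) i = tnth t i.
Proof.
rewrite -[RHS]card_ord -(card_codom (@eq_from_Tagged _ (fun i => 'I_(tnth t i)) i)).
apply: eq_card => x; rewrite !inE; apply/eqP/codomP => [|[y ->] //].
by case: x => j y /= ji; subst j; exists y.
Qed.

Section Isomorphism.
Variables (V W : finType) (D : digraph V) (D' : digraph W).
Variables (r : V -> 'I_5) (r' : W -> 'I_5) (g : 'I_4 -> 'I_4).
Hypotheses (rD : labelling D r) (rD' : labelling D' r') (gI : injective g).
Hypothesis gr : forall i, fiber_card r' (lab_map g i) = fiber_card r i.

Lemma labelled_bij :
  exists2 f : V -> W, bijective f & forall x, r' (f x) = lab_map g (r x).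
Proof.
have sI := lab_map_inj gI; have [s' sK s'K] := injF_bij sI.
apply: (fiber_bij (r := lab_map g \o r)) => i.
by rewrite -!/(fiber_card _ i) (fiber_card_bij _ _ s'K sK) -gr s'K.
Qed.

Lemma isomorphic_labelling :
  (forall u v, herm_entry negtet (g u) (g v) = herm_entry negtet u v) -> isomorphic D D'.
Proof.
move=> gA; have [f fbij fr] := labelled_bij.
exists f => //; apply: isomorphic_herm_entry => x y; rewrite rD' !fr rD.
case: (unliftP ord0 (r x)) => [u ->|->]; last by rewrite lab_mapE !lab_herm0.
case: (unliftP ord0 (r y)) => [v ->|->]; last by rewrite !lab_mapE !lab_herm0.
by rewrite !lab_mapE !lab_herm_lift gA.
Qed.

(** Without the automorphism hypothesis the rearranged digraph still differs only
    by phases, because the switched matrix is symmetric in the four parts. *)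
Lemma cospectral_labelling : cospectral D D'.
Proof.
have [f fbij fr] := labelled_bij.
pose e (i : 'I_5) := if unlift ord0 i is Some u then tet_phase (g u) * (tet_phase u)^* else 1.
apply: (switching_cospectral fbij (e := e \o r)) => [x|x y] /=.
  rewrite /e; case: unlift => [u|]; last by rewrite rmorph1 mulr1.
  by rewrite rmorphM /= conjCK mulrACA tet_phase_unit mul1r mulrC tet_phase_unit.
rewrite rD' !fr rD.
case: (unliftP ord0 (r x)) => [u ->|->]; last by rewrite lab_mapE !lab_herm0 mulr0 mul0r.
case: (unliftP ord0 (r y)) => [v ->|->]; last by rewrite !lab_mapE !lab_herm0 mulr0 mul0r.
rewrite !lab_mapE !lab_herm_lift !herm_entry_negtet (inj_eq gI) /e !liftK rmorphM /= conjCK.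
set k := _ - 1.
have -> : tet_phase (g u) * (tet_phase u)^* * (tet_phase u * (tet_phase v)^* * k) *
      ((tet_phase (g v))^* * tet_phase v) =
    (tet_phase (g u) * (tet_phase (g v))^* * k) *
      (tet_phase u * (tet_phase u)^*) * (tet_phase v * (tet_phase v)^*) by ring.
by rewrite !tet_phase_unit !mulr1.
Qed.
End Isomorphism.

(** * Part sizes, digons, and the characterization *)

Definition part_size (V : finType) (r : V -> 'I_5) (u : 'I_4) : nat :=
  fiber_card r (lift ord0 u).

Lemma ord4_ind (P : 'I_4 -> Prop) : P 0 -> P 1 -> P 2 -> P 3 -> forall u, P u.
Proof.
move=> P0 P1 P2 P3 [[|[|[|[|//]]]] ?].
- by rewrite (_ : Ordinal _ = 0) //; apply: val_inj.
- by rewrite (_ : Ordinal _ = 1) //; apply: val_inj.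
- by rewrite (_ : Ordinal _ = 2) //; apply: val_inj.
- by rewrite (_ : Ordinal _ = 3) //; apply: val_inj.
Qed.

Definition all_but_one (n : 'I_4 -> nat) (a b : nat) (p : 'I_4) : Prop :=
  forall u, n u = if u == p then b else a.

Lemma all_but_one_perm (n : 'I_4 -> nat) a b :
  perm_eq [:: n 0; n 1; n 2; n 3] [:: a; a; a; b] <-> exists p, all_but_one n a b p.
Proof.
split=> [E|[p np]]; last first.
  by rewrite !np; elim/ord4_ind: p {np} => /=; apply/seq.permP => c /=; lia.
have all_a x y z : perm_eq [:: b; x; y; z] [:: n 0; n 1; n 2; n 3] ->
    [/\ x = a, y = a & z = a].
  move/perm_trans/(_ E) => E'; have : perm_eq [:: b; x; y; z] [:: b; a; a; a].
    by apply: perm_trans E' _; apply/seq.permP => c /=; lia.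
  rewrite perm_cons => /perm_mem M.
  by split; apply/eqP; [have := M x|have := M y|have := M z];
    rewrite !inE eqxx /= ?orbT !orbb => /esym.
have := perm_mem E b; rewrite !inE eqxx !orbT => /or4P[] /eqP bE; rewrite bE in all_a *.
- exists 0; have [|E1 E2 E3] := all_a (n 1) (n 2) (n 3).
    by apply/seq.permP => c /=; lia.
  exact: ord4_ind.
- exists 1; have [|E1 E2 E3] := all_a (n 0) (n 2) (n 3).
    by apply/seq.permP => c /=; lia.
  exact: ord4_ind.
- exists 2; have [|E1 E2 E3] := all_a (n 0) (n 1) (n 3).
    by apply/seq.permP => c /=; lia.
  exact: ord4_ind.
- exists 3; have [|E1 E2 E3] := all_a (n 0) (n 1) (n 2).
    by apply/seq.permP => c /=; lia.
  exact: ord4_ind.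
Qed.

Section Cospectral.
Variables (V W : finType) (D : digraph V) (D' : digraph W).
Variables (r : V -> 'I_5) (r' : W -> 'I_5).
Hypotheses (rD : labelling D r) (rD' : labelling D' r').
Hypothesis DD' : cospectral D D'.
Local Notation n := (part_size r).
Local Notation n' := (part_size r').

Lemma cospectral_card : #|V| = #|W|.
Proof.
have /cospectral_unitarily_equivalent/eq_char_poly_unitarily_equivalent := DD'.
rewrite !hermitian_herm_mx => /(_ erefl erefl)/(congr1 (fun p : {poly algC} => size p)).
by rewrite !size_char_poly => -[].
Qed.

Lemma cospectral_esyms :
  esyms (n' 0)%:Z (n' 1)%:Z (n' 2)%:Z (n' 3)%:Z = esyms (n 0)%:Z (n 1)%:Z (n 2)%:Z (n 3)%:Z.
Proof.
have /cospectral_unitarily_equivalent/mxtrace_unitarily_equivalent := DD'.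
have [-> -> ->] := mxtrace_labelling rD; have [-> -> ->] := mxtrace_labelling rD'.
rewrite -!/(part_size _ _) => -[e2 e3 e4].
have injZ (x y : int) : x%:~R = y%:~R :> algC -> x = y by apply: intr_inj.
have nz k : (k.+1)%:R != 0 :> algC by rewrite pnatr_eq0.
have {}e2 := mulfI (nz 1%N) e2; rewrite e2 in e4.
move/addrI/(mulfI (nz 11%N)): e4 => e4.
move: e3; rewrite !mulNr => /oppr_inj/(mulfI (nz 5%N)) e3.
congr (_, _, _); apply: injZ; rewrite /esym2 /esym3 /esym4 in e2 e3 e4 *.
- by rewrite !rmorphD /= !rmorphM /= e2.
- by rewrite !rmorphD /= !rmorphM /= e3.
- by rewrite !rmorphM /= e4.
Qed.
End Cospectral.

Definition digon_count (V : finType) (D : digraph V) : nat :=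
  \sum_x \sum_y (Defs.arc D x y && Defs.arc D y x).

Lemma isomorphic_digon_count (V W : finType) (D : digraph V) (D' : digraph W) :
  isomorphic D D' -> digon_count D = digon_count D'.
Proof.
case=> f fbij fA; rewrite /digon_count [RHS](reindex f) /=; last exact: onW_bij.
apply: eq_bigr => x _; rewrite [RHS](reindex f) /=; last exact: onW_bij.
by apply: eq_bigr => y _; rewrite !fA.
Qed.

Lemma digon_count_TE (t : 5.-tuple nat) (n := fun u : 'I_4 => tnth t (lift ord0 u)) :
  digon_count (TE negtet t) = (2 * (n 0%R * n 1%R + n 2%R * n 3%R))%N.
Proof.
pose dig (i j : 'I_5) : algC :=
  if unlift ord0 i is Some u then if unlift ord0 j is Some v then
    (Defs.arc negtet u v && Defs.arc negtet v u)%:R else 0 else 0.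
have digE x y : (Defs.arc (TE negtet t) x y && Defs.arc (TE negtet t) y x)%:R = dig (tag x) (tag y).
  rewrite /dig /= /TE_arc; case: (unlift _ (tag x)) => // u; case: (unlift _ (tag y)) => // v.
have ext (F : 'I_5 -> algC) : F ord0 = 0 -> \sum_(x : TE_vertex t) F (tag x) = \sum_u (n u)%:R * F (lift ord0 u).
  move=> F0; rewrite (sum_labelling (@tag _ _)) big_ord_recl F0 mulr0 add0r.
  by apply: eq_bigr => u _; rewrite fiber_card_TE.
apply/eqP; rewrite -(eqr_nat algC) /digon_count natr_sum; apply/eqP.
under eq_bigr => x _ do rewrite natr_sum.
under eq_bigr => x _ do under eq_bigr => y _ do rewrite digE.
rewrite (ext (fun i => \sum_y dig i (tag y))); last by apply: big1 => y _; rewrite /dig unlift_none.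
under eq_bigr => u _.
  rewrite ext; last by rewrite /dig liftK unlift_none.
  under eq_bigr => v _ do rewrite /dig !liftK.
  over.
rewrite !sum4 /negtet /= /negtet_arc /= natrM natrD !natrM; ring.
Qed.

(** Each exchange of two part sizes keeps the spectrum, hence by assumption the
    isomorphism type and the digon count.  Exchanging parts [1] and [2], then [1]
    and [3], yields [(n 0 - n 3)(n 1 - n 2) = 0] and [(n 0 - n 2)(n 1 - n 3) = 0]. *)
Lemma SHDS_all_but_one (t : 5.-tuple nat) (n := fun u : 'I_4 => tnth t (lift ord0 u)) :
  SHDS (TE negtet t) -> exists a b p, all_but_one n a b p.
Proof.
move=> shds; have rT := @TE_labelling t.
have swap u v : digon_count (TE negtet t) =
    (2 * (n (tperm u v 0%R) * n (tperm u v 1%R)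
        + n (tperm u v 2%R) * n (tperm u v 3%R)))%N.
  pose t' := [tuple tnth t (lab_map (tperm u v) i) | i < 5].
  have gg : involutive (lab_map (tperm u v)).
    by move=> i; case: (unliftP ord0 i) => [w ->|->]; rewrite !lab_mapE // tpermK.
  have cosp : cospectral (TE negtet t) (TE negtet t').
    apply: (cospectral_labelling rT (@TE_labelling t') (@perm_inj _ (tperm u v))) => i.
    by rewrite !fiber_card_TE tnth_mktuple gg.
  rewrite (isomorphic_digon_count (shds _ _ cosp)) digon_count_TE.
  by rewrite !tnth_mktuple !lab_mapE.
have eq12 := swap 1 2; have eq13 := swap 1 3.
rewrite (swap 0 0) tperm1 !perm1 !permE /= in eq12 eq13.
have cross (x y z w : nat) :
    (2 * (x * y + z * w) = 2 * (x * z + y * w))%N -> x = w \/ y = z.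
  move=> E; have : (x%:Z - w%:Z) * (y%:Z - z%:Z) = 0 by lia.
  by move/eqP; rewrite mulf_eq0 !subr_eq0 !eqz_nat => /orP[] /eqP; [left|right].
have E03 := cross _ _ _ _ eq12.
have E02 : n 0 = n 2 \/ n 1 = n 3.
  by apply: cross; rewrite (mulnC (n 3%R)) (mulnC (n 1%R) (n 2%R)).
case: E03 E02 => [] E [] E'.
- by exists (n 0), (n 1), 1; apply: ord4_ind; rewrite //=.
- by exists (n 0), (n 2), 2; apply: ord4_ind; rewrite //= E' E.
- by exists (n 0), (n 3), 3; apply: ord4_ind; rewrite //= E E'.
- by exists (n 1), (n 0), 0; apply: ord4_ind; rewrite //=.
Qed.

(** Equal rank and signature make [D'] a twin expansion of the negative
    tetrahedron, the symmetric functions give it the same part sizes up to order,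
    and transitivity of the automorphism group repairs the order.  The number of
    isolated vertices then follows from the total. *)
Lemma all_but_one_SHDS (t : 5.-tuple nat) (n := fun u : 'I_4 => tnth t (lift ord0 u)) a b p :
  expansion_vector t -> (0 < a)%N -> (0 < b)%N -> all_but_one n a b p ->
  SHDS (TE negtet t).
Proof.
move=> n0 a0 b0 np W D' cosp; have rT := @TE_labelling t.
have nE : n =1 part_size (@tag _ _ : TE_vertex t -> 'I_5).
  by move=> u; rewrite /part_size fiber_card_TE.
have UE := (cospectral_unitarily_equivalent _ _).1 cosp.
have onto u : exists x : TE_vertex t, tag x = lift ord0 u.
  by exists (Tagged (fun i : 'I_5 => 'I_(tnth t i)) (Ordinal (n0 u))).
have [r' rD' r'_onto] : exists2 r : W -> 'I_5, labelling D' r &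
    forall u, exists x, r x = lift ord0 u.
  apply: tetrahedral_labelling.
    exact: nonneg_on_hyperplane_unitarily_equivalent UE (labelling_nonneg_on_hyperplane rT).
  by rewrite -(mxrank_unitarily_equivalent UE) (mxrank_labelling rT onto).
have [p' np'] : exists p', all_but_one (part_size r') a b p'.
  apply/all_but_one_perm.
  have n'0 u : 0 < (part_size r' u)%:Z.
    by rewrite ltz_nat; apply/card_gt0P; have [x xu] := r'_onto u; exists x; rewrite inE xu.
  apply: (@perm_map_inj _ _ Posz); first by move=> x y [].
  apply: perm_esyms => //; rewrite (cospectral_esyms rT rD' cosp) -!nE !np.
  by elim/ord4_ind: (p) => /=; rewrite /esyms /esym2 /esym3 /esym4; congr (_, _, _); ring.
have [g [gI gp gA]] := tet_automorphism p p'.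
apply: (isomorphic_labelling rT rD' gI _ gA) => i.
have partE u : part_size r' (g u) = part_size (@tag _ _ : TE_vertex t -> 'I_5) u.
  by rewrite -nE np np' -gp (inj_eq gI).
case: (unliftP ord0 i) => [u ->|->]; rewrite lab_mapE; first exact: partE.
have := cospectral_card cosp.
rewrite (card_fibers (@tag _ _ : TE_vertex t -> 'I_5)) (card_fibers r').
have -> : \sum_u fiber_card r' (lift ord0 u) =
    \sum_u fiber_card (@tag _ _ : TE_vertex t -> 'I_5) (lift ord0 u).
  by rewrite (reindex_inj gI); apply: eq_bigr => u _; apply: partE.
by move/addIn.
Qed.

Local Close Scope sesquilinear_scope.
Local Close Scope ring_scope.

Theorem theorem5p3 (t : 5.-tuple nat) (ht : expansion_vector t) :
  SHDS (TE negtet t) <->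
  exists (t0 t1 t2 : nat) (tau : seq nat),
    [/\ 0 < t1, 0 < t2, perm_eq tau [:: t1; t1; t1; t2]
      & tval t = t0 :: tau].
Proof.
pose n (u : 'I_4) : nat := tnth t (lift ord0 u).
have tE : tval t = tnth t ord0 :: [:: n 0%R; n 1%R; n 2%R; n 3%R].
  by rewrite /n !(tnth_nth 0); case: (t) => [[|t0 [|x [|y [|z [|w []]]]]]].
split=> [/SHDS_all_but_one[a [b [p np]]]|[t0 [a [b [tau [a0 b0 tauE ttau]]]]]].
  have [u pu] : exists u, p != u.
    by exists (if p == 0%R then 1%R else 0%R); case: (eqVneq p 0%R) => [->|].
  exists (tnth t ord0), a, b, [:: n 0%R; n 1%R; n 2%R; n 3%R]; split=> //.
  - by have := ht u; rewrite np eq_sym (negPf pu).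
  - by have := ht p; rewrite np eqxx.
  - by apply/all_but_one_perm; exists p.
have [p np] : exists p, all_but_one n a b p.
  by apply/all_but_one_perm; move: ttau tauE; rewrite tE => -[_ <-].
exact: all_but_one_SHDS np.
Qed.
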